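(* Let $\mathcal{H}$ be an essential non-central hyperplane arrangement in $\mathbb{R}^n$ with intersection lattice $\mathcal{L}$. Let $c=\{\hat0=x_0<x_1<\dots<x_k=\hat1\}$ be a chain in $\mathcal{L}\cup\{\hat0\}$ with $k\ge2$. Then the number of chains $d=\{y_0<y_1<\dots<y_k\}$ in $Q$ with $z_{ub}(y_i)=x_i$ for all $i$ is $$|z_{ub}^{-1}(c)|=\prod_{i=2}^{k-1}Z([x_{i-1},x_i])\cdot Z_{ub}([x_{k-1},x_k]).$$
   Context: A hyperplane arrangement is a finite set of affine hyperplanes in $\mathbb{R}^n$; it is essential if the normals span $\mathbb{R}^n$ and non-central if the intersection of all its hyperplanes is empty. The intersection lattice $\mathcal{L}$ consists of all nonempty intersections of subsets of the hyperplanes (the empty intersection being $\mathbb{R}^n$) together with $\emptyset$ as maximum, ordered by reverse inclusion, with ranks $\rho(x)=n-\dim x$, $\rho(\emptyset)=n+1$. $\mathcal{L}\cup\{\hat0\}$ is $\mathcal{L}$ with a new minimum $\hat0$ and all other ranks increased by 1; its maximum $\hat1$ is $\emptyset$. The faces of $\mathcal{H}$ are the nonempty relatively open cells of the induced decomposition of $\mathbb{R}^n$; the face lattice $T$ consists of the faces together with an empty face (minimum) and a maximum, ordered by $F\le G$ iff $F\subseteq\bar G$; $T^*$ is its dual, ranked so that its minimum has rank $0$, a face of dimension $i$ has rank $n+1-i$, and its maximum (the empty face) has rank $n+2$. $Q$ is the subposet of $T^*$ consisting of its minimum and all unbounded faces, together with an adjoined maximum of rank $n+2$; elements keep their $T^*$-ranks.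 $z_{ub}:Q\to\mathcal{L}\cup\{\hat0\}$ sends the minimum to $\hat0$, each face to its affine hull, and the maximum to $\emptyset$. For an interval $[x,y]$ with Möbius function $\mu$: $Z([x,y])=\sum_{x\le w\le y}(-1)^{\rho(w)-\rho(x)}\mu(x,w)$, $Z_b([x,y])=(-1)^{\rho(y)-\rho(x)}\mu(x,y)$, and $Z_{ub}=Z-2Z_b$. *)

(* Defs.v *)
From HB Require Import structures.
From mathcomp Require Import all_boot all_order all_algebra finmap.
From mathcomp Require Import all_classical all_reals.
From mathcomp Require Import topology normedtype lra.

Set Implicit Arguments.
Unset Strict Implicit.
Unset Printing Implicit Defensive.

Import Order.TTheory GRing.Theory Num.Theory.
Import numFieldNormedType.Exports.

Local Open Scope classical_set_scope.
Local Open Scope ring_scope.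

(* The Moebius function of a finite poset.  The first argument of [mobius_rec]
   is only fuel for the recursion on the second endpoint; [mobiusxx] and
   [mobius_sum] below are the defining equations. *)

Fixpoint mobius_rec (f : nat) (d : Order.disp_t) (P : finPOrderType d)
    (x y : P) : int :=
  if f is f'.+1 then
    if x == y then 1
    else if (x < y)%O then - \sum_(z : P | (x <= z < y)%O) mobius_rec f' x z
    else 0
  else 0.

Definition mobius (d : Order.disp_t) (P : finPOrderType d) (x y : P) : int :=
  mobius_rec #|P| x y.

Definition Zint (d : Order.disp_t) (P : finPOrderType d) (rho : P -> nat)
    (x y : P) : int :=
  \sum_(w : P | (x <= w <= y)%O) (-1) ^+ (rho w - rho x)%N * mobius x w.

Definition Zint_b (d : Order.disp_t) (P : finPOrderType d) (rho : P -> nat)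
    (x y : P) : int :=
  (-1) ^+ (rho y - rho x)%N * mobius x y.

Definition Zint_ub (d : Order.disp_t) (P : finPOrderType d) (rho : P -> nat)
    (x y : P) : int :=
  Zint rho x y - 2 * Zint_b rho x y.

Lemma mobius_recE (d : Order.disp_t) (P : finPOrderType d) (x : P) (f g : nat)
    (y : P) :
  (#|[pred z : P | (x <= z <= y)%O]| <= f)%N -> (f <= g)%N ->
  mobius_rec f x y = mobius_rec g x y.
Proof.
elim: f g y => [|f IHf] [|g] y //=.
- rewrite leqn0 => /eqP/card0_eq c0 _; have := c0 x; have := c0 y.
  rewrite !inE !lexx andbT /= => xy0.
  case: eqP => [xy|_]; first by rewrite xy lexx in xy0.
  by move=> _; case: ifP => // /ltW; rewrite xy0.
- move=> cf fg; case: eqP => // _; case: ifP => // xy; congr (- _).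
  apply: eq_bigr => z /andP[xz zy]; apply: IHf => //.
  rewrite -ltnS; apply: leq_trans cf; apply: proper_card.
  apply/properP; split.
    apply/fintype.subsetP => w; rewrite !inE => /andP[-> wz].
    exact: le_trans wz (ltW zy).
  exists y; rewrite !inE; first by rewrite (ltW xy) lexx.
  by rewrite (lt_geF zy) andbF.
Qed.

Lemma mobiusxx (d : Order.disp_t) (P : finPOrderType d) (x : P) :
  mobius x x = 1.
Proof.
rewrite /mobius; have : (0 < #|P|)%N by apply/card_gt0P; exists x.
by case: #|P| => //= f _; rewrite eqxx.
Qed.

Lemma mobius_sum (d : Order.disp_t) (P : finPOrderType d) (x y : P) :
  (x < y)%O -> \sum_(z : P | (x <= z <= y)%O) mobius x z = 0.
Proof.
move=> xy; rewrite (bigD1 y) /=; last by rewrite (ltW xy) lexx.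
have -> : mobius x y = - \sum_(z : P | (x <= z < y)%O) mobius x z.
  rewrite /mobius (@mobius_recE _ _ x #|P| #|P|.+1 y) ?max_card //=.
  by rewrite (lt_eqF xy) xy.
apply/eqP; rewrite addrC subr_eq0; apply/eqP; apply: eq_bigl => z.
by rewrite lt_neqAle -andbA [X in _ && X]andbC.
Qed.

Variant with_bot (P : Type) : Type := Bot | BElt of P.
Variant with_top (P : Type) : Type := Top | TElt of P.
Arguments Bot {P}.
Arguments Top {P}.

Definition option_of_with_bot (P : Type) (x : with_bot P) : option P :=
  if x is BElt a then Some a else None.
Definition with_bot_of_option (P : Type) (x : option P) : with_bot P :=
  if x is Some a then BElt a else Bot.
Lemma option_of_with_botK (P : Type) :
  cancel (@option_of_with_bot P) (@with_bot_of_option P).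
Proof. by case. Qed.
HB.instance Definition _ (P : finType) :=
  Finite.copy (with_bot P) (can_type (@option_of_with_botK P)).

Definition option_of_with_top (P : Type) (x : with_top P) : option P :=
  if x is TElt a then Some a else None.
Definition with_top_of_option (P : Type) (x : option P) : with_top P :=
  if x is Some a then TElt a else Top.
Lemma option_of_with_topK (P : Type) :
  cancel (@option_of_with_top P) (@with_top_of_option P).
Proof. by case. Qed.
HB.instance Definition _ (P : finType) :=
  Finite.copy (with_top P) (can_type (@option_of_with_topK P)).

Definition with_bot_le (d : Order.disp_t) (P : finPOrderType d)
    (x y : with_bot P) : bool :=
  match x, y with
  | Bot, _ => true
  | BElt _, Bot => false
  | BElt a, BElt b => (a <= b)%O
  end.

Lemma with_bot_le_refl (d : Order.disp_t) (P : finPOrderType d) :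
  reflexive (@with_bot_le d P).
Proof. by case=> //= a; exact: lexx. Qed.
Lemma with_bot_le_anti (d : Order.disp_t) (P : finPOrderType d) :
  antisymmetric (@with_bot_le d P).
Proof. by case=> [|a] [|b] //= /le_anti ->. Qed.
Lemma with_bot_le_trans (d : Order.disp_t) (P : finPOrderType d) :
  transitive (@with_bot_le d P).
Proof. by case=> [|a] [|b] [|c] //=; exact: le_trans. Qed.
HB.instance Definition _ (d : Order.disp_t) (P : finPOrderType d) :=
  Order.Le_isPOrder.Build d (with_bot P) (@with_bot_le_refl d P)
    (@with_bot_le_anti d P) (@with_bot_le_trans d P).

Definition with_top_le (d : Order.disp_t) (P : finPOrderType d)
    (x y : with_top P) : bool :=
  match x, y with
  | _, Top => true
  | Top, TElt _ => false
  | TElt a, TElt b => (a <= b)%O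
  end.

Lemma with_top_le_refl (d : Order.disp_t) (P : finPOrderType d) :
  reflexive (@with_top_le d P).
Proof. by case=> //= a; exact: lexx. Qed.
Lemma with_top_le_anti (d : Order.disp_t) (P : finPOrderType d) :
  antisymmetric (@with_top_le d P).
Proof. by case=> [|a] [|b] //= /le_anti ->. Qed.
Lemma with_top_le_trans (d : Order.disp_t) (P : finPOrderType d) :
  transitive (@with_top_le d P).
Proof. by case=> [|a] [|b] [|c] //=; exact: le_trans. Qed.
HB.instance Definition _ (d : Order.disp_t) (P : finPOrderType d) :=
  Order.Le_isPOrder.Build d (with_top P) (@with_top_le_refl d P)
    (@with_top_le_anti d P) (@with_top_le_trans d P).

Definition dot (R : realType) (n : nat) (u v : 'rV[R]_n) : R :=
  \sum_j u ord0 j * v ord0 j.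

Definition affine_hull (R : realType) (n : nat) (S : set 'rV[R]_n) :
    set 'rV[R]_n :=
  [set p | exists (k : nat) (x : 'I_k -> 'rV[R]_n) (a : 'I_k -> R),
     [/\ forall i, S (x i), \sum_i a i = 1 & p = \sum_i a i *: x i]].

(* The dimension of a nonempty affine subspace is that of its (unique)
   direction space; the value at other sets is irrelevant. *)
Definition affine_dim (R : realType) (n : nat) (S : set 'rV[R]_n) : nat :=
  \dim (xget 0%VS [set V : {vspace 'rV[R]_n} |
                   exists p, S = [set q | q - p \in V]]).

(* Finite sets of hyperplanes {x | normal i . x = offset i}, without
   repetition. *)
Record arrangement (R : realType) (n : nat) := Arrangement {
  nhyp : nat;
  normal : 'I_nhyp -> 'rV[R]_n;
  offset : 'I_nhyp -> R;
  normal_neq0 : forall i, normal i != 0;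
  hyperplane_inj :
    injective (fun i => [set x : 'rV[R]_n | dot (normal i) x = offset i])
}.

Definition hyperplane (R : realType) (n : nat) (A : arrangement R n)
    (i : 'I_(nhyp A)) : set 'rV[R]_n :=
  [set x | dot (normal i) x = offset i].

Definition essential (R : realType) (n : nat) (A : arrangement R n) : Prop :=
  <<[seq normal i | i : 'I_(nhyp A)]>>%VS = fullv.

Definition noncentral (R : realType) (n : nat) (A : arrangement R n) : Prop :=
  \bigcap_(i in [set: 'I_(nhyp A)]) hyperplane i = set0.

Definition flat (R : realType) (n : nat) (A : arrangement R n)
    (B : {set 'I_(nhyp A)}) : set 'rV[R]_n :=
  \bigcap_(i in [set i | i \in B]) hyperplane i.

(* Intersections of subfamilies that happen to be empty contribute the same
   element [set0] as the adjoined maximum. *)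
Definition flats (R : realType) (n : nat) (A : arrangement R n) :
    {fset (set 'rV[R]_n)} :=
  (set0 |` [fset flat B | B : {set 'I_(nhyp A)}])%fset.

Definition int_lattice (R : realType) (n : nat) (A : arrangement R n) : Type :=
  flats A.
HB.instance Definition _ (R : realType) (n : nat) (A : arrangement R n) :=
  Finite.copy (int_lattice A) (flats A).

Definition int_lattice_le (R : realType) (n : nat) (A : arrangement R n)
    (x y : int_lattice A) : bool :=
  `[< fsval y `<=` fsval x >].

Lemma int_lattice_le_refl (R : realType) (n : nat) (A : arrangement R n) :
  reflexive (@int_lattice_le R n A).
Proof. by move=> x; apply/asboolP. Qed.
Lemma int_lattice_le_anti (R : realType) (n : nat) (A : arrangement R n) :
  antisymmetric (@int_lattice_le R n A).
Proof.
move=> x y /andP[/asboolP yx /asboolP xy].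
by apply/val_inj/seteqP; split.
Qed.
Lemma int_lattice_le_trans (R : realType) (n : nat) (A : arrangement R n) :
  transitive (@int_lattice_le R n A).
Proof.
move=> y x z /asboolP yx /asboolP zy; apply/asboolP.
exact: subset_trans zy yx.
Qed.
HB.instance Definition _ (R : realType) (n : nat) (A : arrangement R n) :=
  Order.Le_isPOrder.Build Order.default_display (int_lattice A)
    (@int_lattice_le_refl R n A) (@int_lattice_le_anti R n A)
    (@int_lattice_le_trans R n A).

Lemma set0_flats (R : realType) (n : nat) (A : arrangement R n) :
  set0 \in flats A.
Proof. by rewrite !inE eqxx. Qed.

Definition empty_flat (R : realType) (n : nat) (A : arrangement R n) :
    int_lattice A :=
  [` set0_flats A]%fset.

Definition int_rank (R : realType) (n : nat) (A : arrangement R n)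
    (x : int_lattice A) : nat :=
  if x == empty_flat A then n.+1 else (n - affine_dim (fsval x))%N.

Definition int_lattice0 (R : realType) (n : nat) (A : arrangement R n) : Type :=
  with_bot (int_lattice A).
HB.instance Definition _ (R : realType) (n : nat) (A : arrangement R n) :=
  Order.FinPOrder.copy (int_lattice0 A) (with_bot (int_lattice A)).

Definition hat0 (R : realType) (n : nat) (A : arrangement R n) :
    int_lattice0 A := Bot.
Definition hat1 (R : realType) (n : nat) (A : arrangement R n) :
    int_lattice0 A := BElt (empty_flat A).

Definition int_rank0 (R : realType) (n : nat) (A : arrangement R n)
    (x : int_lattice0 A) : nat :=
  if x is BElt y then (int_rank y).+1 else 0%N.

(* A sign vector s prescribes for each hyperplane whether a point lies
   on it ([None]) or strictly on one of its sides ([Some _]). *)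

Definition open_side (R : realType) (n : nat) (A : arrangement R n)
    (i : 'I_(nhyp A)) (s : option bool) : set 'rV[R]_n :=
  match s with
  | None => hyperplane i
  | Some true => [set x | offset i < dot (normal i) x]
  | Some false => [set x | dot (normal i) x < offset i]
  end.

Definition cell (R : realType) (n : nat) (A : arrangement R n)
    (s : {ffun 'I_(nhyp A) -> option bool}) : set 'rV[R]_n :=
  \bigcap_(i in [set: 'I_(nhyp A)]) open_side i (s i).

Definition faces (R : realType) (n : nat) (A : arrangement R n) :
    {fset (set 'rV[R]_n)} :=
  ([fset cell s | s : {ffun 'I_(nhyp A) -> option bool}] `\ set0)%fset.

Definition face (R : realType) (n : nat) (A : arrangement R n) : Type :=
  faces A.
HB.instance Definition _ (R : realType) (n : nat) (A : arrangement R n) :=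
  Finite.copy (face A) (faces A).

Definition face_le (R : realType) (n : nat) (A : arrangement R n)
    (F G : face A) : bool :=
  `[< fsval F `<=` closure (fsval G) >].

Lemma face_le_refl (R : realType) (n : nat) (A : arrangement R n) :
  reflexive (@face_le R n A).
Proof. by move=> F; apply/asboolP; exact: subset_closure. Qed.

Lemma face_le_trans (R : realType) (n : nat) (A : arrangement R n) :
  transitive (@face_le R n A).
Proof.
move=> G F H /asboolP FG /asboolP GH; apply/asboolP.
apply: (subset_trans FG).
rewrite [X in _ `<=` X](closure_id _).1; last exact: closed_closure.
exact: closureS.
Qed.

Lemma faceP (R : realType) (n : nat) (A : arrangement R n) (F : face A) :
  (exists s, fsval F = cell (A := A) s) /\ fsval F !=set0.
Proof.
have := fsvalP F; rewrite !inE => /andP[/set0P F0 /imfsetP[s _ Fs]].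
by split=> //; exists s.
Qed.

Lemma dot_continuous (R : realType) (n : nat) (u : 'rV[R]_n) :
  continuous (dot u).
Proof.
apply: continuous_big => [|j _]; first exact: add_continuous.
move=> x; apply: (@continuousM R 'rV[R]_n (fun=> u ord0 j)
  (fun v : 'rV[R]_n => v ord0 j)); first exact: cst_continuous.
exact: coord_continuous.
Qed.

Lemma dotD (R : realType) (n : nat) (u x y : 'rV[R]_n) :
  dot u (x + y) = dot u x + dot u y.
Proof. by rewrite -big_split; apply: eq_bigr => j _; rewrite mxE mulrDr. Qed.

Lemma dotZ (R : realType) (n : nat) (u : 'rV[R]_n) (a : R) (x : 'rV[R]_n) :
  dot u (a *: x) = a * dot u x.
Proof. by rewrite /dot mulr_sumr; apply: eq_bigr => j _; rewrite mxE mulrCA. Qed.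

Lemma dot_sum (R : realType) (n : nat) (u : 'rV[R]_n) (k : nat)
    (x : 'I_k -> 'rV[R]_n) : dot u (\sum_i x i) = \sum_i dot u (x i).
Proof.
apply: (big_morph (dot u) (dotD u)).
by apply: big1 => j _; rewrite mxE mulr0.
Qed.

Definition closed_side (R : realType) (n : nat) (A : arrangement R n)
    (i : 'I_(nhyp A)) (s : option bool) : set 'rV[R]_n :=
  match s with
  | None => hyperplane i
  | Some true => [set x | offset i <= dot (normal i) x]
  | Some false => [set x | dot (normal i) x <= offset i]
  end.

Lemma closed_closed_side (R : realType) (n : nat) (A : arrangement R n)
    (i : 'I_(nhyp A)) (s : option bool) : closed (closed_side i s).
Proof.
have cd := @dot_continuous R n (normal i).
case: s => [[]|] /=.
- by apply: (@preimage_closed _ _ (dot (normal i)) [set y | offset i <= y]);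
    [move=> *; exact: cd | exact: closed_ge].
- by apply: (@preimage_closed _ _ (dot (normal i)) [set y | y <= offset i]);
    [move=> *; exact: cd | exact: closed_le].
- by apply: (@preimage_closed _ _ (dot (normal i)) [set y | y = offset i]);
    [move=> *; exact: cd | exact: closed_eq].
Qed.

Lemma closure_cell (R : realType) (n : nat) (A : arrangement R n)
    (s : {ffun 'I_(nhyp A) -> option bool}) (i : 'I_(nhyp A)) :
  closure (cell s) `<=` closed_side i (s i).
Proof.
rewrite [X in _ `<=` X](closure_id _).1; last exact: closed_closed_side.
apply: closureS => x /(_ i I); case: (s i) => [[]|] //=; exact: ltW.
Qed.

Lemma face_le_anti (R : realType) (n : nat) (A : arrangement R n) :
  antisymmetric (@face_le R n A).
Proof.
move=> F G /andP[/asboolP FG /asboolP GF].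
have [[s Fs] [x Fx]] := faceP F; have [[t Gt] [y Gy]] := faceP G.
apply: val_inj; rewrite /= Fs Gt; congr cell; apply/ffunP => i.
move/FG: (Fx); move/GF: (Gy); rewrite Fs Gt => /(@closure_cell _ _ _ _ i) ys.
move=> /(@closure_cell _ _ _ _ i) xt.
move: Fx Gy; rewrite Fs Gt => /(_ i I) xs /(_ i I) yt; move: xs yt ys xt.
clear FG GF Fs Gt.
case: (s i) => [[]|]; case: (t i) => [[]|] //=; rewrite /hyperplane /= =>
  *; exfalso; lra.
Qed.

HB.instance Definition _ (R : realType) (n : nat) (A : arrangement R n) :=
  Order.Le_isPOrder.Build Order.default_display (face A)
    (@face_le_refl R n A) (@face_le_anti R n A) (@face_le_trans R n A).

(* The face lattice T: [Bot] is the empty face.  Its dual T^* is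
   [(face_lattice A)^d], whose minimum is [BElt Top] and whose maximum is the
   empty face [Bot]. *)
Definition face_lattice (R : realType) (n : nat) (A : arrangement R n) : Type :=
  with_bot (with_top (face A)).
HB.instance Definition _ (R : realType) (n : nat) (A : arrangement R n) :=
  Order.FinPOrder.copy (face_lattice A) (with_bot (with_top (face A))).

Lemma affine_hull_cell (R : realType) (n : nat) (A : arrangement R n)
    (s : {ffun 'I_(nhyp A) -> option bool}) :
  cell s !=set0 ->
  affine_hull (cell s) = flat [set i | s i == None]%SET.
Proof.
move=> [x0 sx0]; apply/seteqP; split=> p.
  move=> [k [x [a [xs a1 ->]]]] i /=; rewrite inE => /eqP si.
  rewrite /hyperplane /= dot_sum -[RHS]mul1r -a1 mulr_suml.
  apply: eq_bigr => j _; rewrite dotZ.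
  by have := xs j i I; rewrite si /= => ->.
move=> sp.
have [e e0 se] : exists2 e : R, e != 0 & cell s (x0 + e *: (p - x0)).
  suff : \forall e \near 0^'+, cell s (x0 + e *: (p - x0)).
    move=> H; have : \forall e \near (0 : R)^'+, e != 0 /\ cell s (x0 + e *: (p - x0)).
      near=> e; split; last by near: e.
      by rewrite gt_eqF//; near: e; exact: nbhs_right_gt.
    by move=> /filter_ex[e []]; exists e.
  suff : \forall e \near 0^'+, forall i : 'I_(nhyp A),
      open_side i (s i) (x0 + e *: (p - x0)).
    by apply: filterS => e H i _; exact: H.
  apply: filter_forall => i.
  have dE (e : R) : dot (normal i) (x0 + e *: (p - x0)) =
      dot (normal i) x0 + e * dot (normal i) (p - x0) by rewrite dotD dotZ.
  have cvgd : dot (normal i) x0 + e * dot (normal i) (p - x0) @[e --> (0 : R)^'+]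
      --> dot (normal i) x0.
    rewrite -[X in _ --> X]addr0 -[X in _ --> _ + X](mul0r (dot (normal i) (p - x0))).
    apply: cvgD; first exact: cvg_cst.
    apply: cvgM; last exact: cvg_cst.
    by apply: cvg_at_right_filter; exact: cvg_id.
  have := sx0 i I; have := sp i; rewrite /= inE.
  case: (s i) => [[]|] /= => [_ lt0|_ lt0|/(_ isT) pi x0i].
  - near=> e; rewrite /= dE; near: e.
    exact: (cvgr_gt _ cvgd).
  - near=> e; rewrite /= dE; near: e.
    exact: (cvgr_lt _ cvgd).
  - near=> e; rewrite /hyperplane /= dotD dotZ.
    have -> : p - x0 = p + (-1) *: x0 by rewrite scaleN1r.
    by rewrite dotD dotZ pi x0i mulN1r subrr mulr0 addr0.
exists 2%N, (fun i => if i == ord0 then x0 else x0 + e *: (p - x0)),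
  (fun i => if i == ord0 then 1 - e^-1 else e^-1); split.
- by move=> i; case: ifP.
- by rewrite !big_ord_recl big_ord0 /= addr0 subrK.
- rewrite !big_ord_recl big_ord0 /= addr0 scalerDr scalerA mulVf// scale1r.
  by rewrite addrA -scalerDl subrK scale1r addrC subrK.
Unshelve. all: by end_near. Qed.

Lemma affine_hull_face (R : realType) (n : nat) (A : arrangement R n)
    (F : face A) : affine_hull (fsval F) \in flats A.
Proof.
have [[s Fs] F0] := faceP F; rewrite Fs in F0 *.
rewrite affine_hull_cell// !inE; apply/orP; right.
by apply/imfsetP; exists [set i | s i == None]%SET.
Qed.

Definition face_hull (R : realType) (n : nat) (A : arrangement R n)
    (F : face A) : int_lattice A :=
  [` affine_hull_face F]%fset.

(* On T^*; [z_ub] is its restriction to the unbounded part, extended to the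
   adjoined maximum. *)
Definition zmap (R : realType) (n : nat) (A : arrangement R n)
    (t : (face_lattice A)^d) : int_lattice0 A :=
  match t with
  | BElt Top => hat0 A
  | BElt (TElt F) => BElt (face_hull F)
  | Bot => hat1 A
  end.

Definition min_or_unbounded (R : realType) (n : nat) (A : arrangement R n)
    (t : (face_lattice A)^d) : bool :=
  match t with
  | BElt Top => true
  | BElt (TElt F) => `[< ~ bounded_set (fsval F) >]
  | Bot => false
  end.

Record unbounded_part (R : realType) (n : nat) (A : arrangement R n) :=
  UnboundedPart {
    ub_val : (face_lattice A)^d;
    ub_valP : min_or_unbounded ub_val
  }.
HB.instance Definition _ (R : realType) (n : nat) (A : arrangement R n) :=
  [isSub for @ub_val R n A].
HB.instance Definition _ (R : realType) (n : nat) (A : arrangement R n) :=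
  [Finite of unbounded_part A by <:].
HB.instance Definition _ (R : realType) (n : nat) (A : arrangement R n) :=
  [SubChoice_isSubPOrder of unbounded_part A by <:
     with Order.default_display].

Definition Qposet (R : realType) (n : nat) (A : arrangement R n) : Type :=
  with_top (unbounded_part A).
HB.instance Definition _ (R : realType) (n : nat) (A : arrangement R n) :=
  Order.FinPOrder.copy (Qposet A) (with_top (unbounded_part A)).

Definition z_ub (R : realType) (n : nat) (A : arrangement R n)
    (q : Qposet A) : int_lattice0 A :=
  if q is TElt t then zmap (ub_val t) else hat1 A.

(* Main.v *)
(* An integer function of the cells cut out by sign conditions that is additive
   whenever a hyperplane cuts a cell into three pieces equals the sum of its
   values over the faces contained in the cell.  Two such functions are used:
   (-1)^dim C, and (-1)^dim C times the Euler characteristic with compact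
   supports of the recession cone of C, which vanishes on unbounded faces when
   the arrangement is essential.  For a nonempty flat X they give three
   alternating sums of (-1)^dim F: it is (-1)^dim X over all faces F in X, and
   also over the faces F in X whose closure contains a fixed face G, and it is 1
   over the bounded faces F in X.  Moebius inversion in the intersection lattice
   turns them into Zaslavsky's counts: Z([X, aff G]) faces with hull X have G in
   their closure, Z_b([X, 1]) faces with hull X are bounded, and Z - Z_b is the
   number of all faces with hull X, hence Z_ub([X, 1]) of them are unbounded.
   A chain in the fibre is built from the top downwards; a face whose closure
   contains an unbounded face is unbounded, so the numbers of choices
   multiply. *)
Require Import Defs.
From HB Require Import structures.
From mathcomp Require Import all_boot all_order all_algebra finmap.
From mathcomp Require Import all_classical all_reals.
From mathcomp Require Import topology normedtype derive ring lra zify.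

Set Implicit Arguments.
Unset Strict Implicit.
Unset Printing Implicit Defensive.

Import Order.TTheory GRing.Theory Num.Theory.
Import numFieldNormedType.Exports.

Local Open Scope ring_scope.

(** * Moebius inversion and counting of chains *)

Lemma mobius_inversion_fibers (d : Order.disp_t) (P : finPOrderType d)
    (T : finType) (V : zmodType) (h : T -> P) (q : pred T) (w : T -> V)
    (f : P -> V) (x y : P) :
  (forall t, q t -> (h t <= y)%O) ->
  (forall z, (x <= z <= y)%O -> \sum_(t | q t && (z <= h t)%O) w t = f z) ->
  \sum_(t | q t && (h t == x)) w t =
  \sum_(z : P | (x <= z <= y)%O) f z *~ mobius x z.
Proof.
move=> hy fE; under [RHS]eq_bigr => z zI do rewrite -fE// mulrz_suml.
rewrite (exchange_big_dep (fun t => q t && (x <= h t)%O)) /=; last first.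
  by move=> z t /andP[xz _] /andP[-> /(le_trans xz)].
rewrite [LHS](eq_bigl (fun t => q t && (x <= h t)%O && (h t == x))); last first.
  by move=> t; rewrite -andbA; case: eqP => [->|]; rewrite ?lexx ?andbF.
rewrite big_mkcondr; apply: eq_bigr => t /andP[qt xt]; rewrite -mulrz_sumr.
rewrite (eq_bigl (fun z => (x <= z <= h t)%O)) => [|z]; last first.
  rewrite qt /=; case: (boolP (z <= h t)%O) => zt; rewrite ?andbF// !andbT.
  by rewrite (le_trans zt (hy t qt)) andbT.
case: eqVneq => [->|tx].
  by rewrite (big_pred1 x) ?mobiusxx// => z; rewrite /= andbC -eq_le.
by rewrite mobius_sum ?mulr0z// lt_neqAle eq_sym tx.
Qed.

Lemma eq_map_tnth (T : Type) (U : eqType) (f : T -> U) k (y : k.-tuple T)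
    (x : k.-tuple U) :
  (map f y == x) = [forall i, f (tnth y i) == tnth x i].
Proof.
rewrite -[LHS]/(map_tuple f y == x) eqEtuple.
by apply: eq_forallb => i; rewrite tnth_map.
Qed.

Section ChainLifts.
Variables (T : finType) (U : eqType) (e : rel T) (f : T -> U).

Definition chain_lifts k (x : k.-tuple U) : pred (k.-tuple T) :=
  [pred y : k.-tuple T | sorted e y && (map f y == x)].

Lemma card_chain_lifts1 a :
  #|chain_lifts [tuple a]| = #|[pred y | f y == a]|.
Proof.
rewrite -!sum1_card (reindex (fun y : T => [tuple y])) /=.
  by apply: eq_bigl => y; rewrite !inE /= eqseq_cons andbT.
exists (@thead _ _) => [//|y _]; case/tupleP: y => y t; rewrite theadE.
by rewrite [t]tuple0; apply: val_inj.
Qed.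

Lemma card_chain_lifts_cons k a (x : k.+1.-tuple U) :
  #|chain_lifts [tuple of a :: x]| =
  \sum_(y in chain_lifts x) #|[pred z | (f z == a) && e z (thead y)]|.
Proof.
under eq_bigr do rewrite -sum1_card; rewrite pair_big_dep -sum1_card /=.
rewrite (reindex (fun u : k.+1.-tuple T * T => [tuple of u.2 :: u.1])) /=.
  apply: eq_bigl => -[y z]; case/tupleP: y => w y.
  by rewrite !inE /= theadE eqseq_cons andbACA andbC [e _ _ && _]andbC.
exists (fun y : k.+2.-tuple T => ([tuple of behead y], thead y)) => [[y z]|y] _.
  by rewrite theadE; congr (_, _); apply: val_inj.
by rewrite -tuple_eta.
Qed.

Lemma card_chain_lifts (S : pzSemiRingType) (r : rel U) (c : U -> U -> S) :
  (forall a b y, r a b -> f y = b ->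
     #|[pred z | (f z == a) && e z y]|%:R = c a b) ->
  forall x0 k (x : k.+1.-tuple U), sorted r x ->
  #|chain_lifts x|%:R =
  (\prod_(0 <= i < k) c (nth x0 x i) (nth x0 x i.+1)) *
  #|[pred y | f y == nth x0 x k]|%:R.
Proof.
move=> ext x0; elim=> [|k IHk] x; case/tupleP: x => a x.
  by rewrite [x]tuple0 /= card_chain_lifts1 big_geq ?mul1r.
case/tupleP: x => b x /= /andP[rab xr]; rewrite card_chain_lifts_cons.
rewrite natr_sum [LHS](eq_bigr (fun=> c a b)) => [|y]; last first.
  move=> /andP[_]; case/tupleP: y => y t /=.
  by rewrite eqseq_cons theadE => /andP[/eqP fy _]; exact: ext.
rewrite sumr_const -[LHS]mulr_natr big_nat_recl//= -mulrA; congr (_ * _).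
exact: IHk [tuple of b :: x] xr.
Qed.

End ChainLifts.

(** * Signs and convex cones *)

Section Signs.
Variable R : realFieldType.
Implicit Types (a b k m : R) (o : option bool).

Definition sign_of a : option bool := if a == 0 then None else Some (0 < a).

Variant sign_of_spec a : option bool -> Prop :=
| SignZero of a = 0 : sign_of_spec a None
| SignPos of 0 < a : sign_of_spec a (Some true)
| SignNeg of a < 0 : sign_of_spec a (Some false).

Lemma sign_ofP a : sign_of_spec a (sign_of a).
Proof. by rewrite /sign_of; case: (ltgtP a 0); constructor. Qed.

(* The order on signs for which a face lies in the closure of another one
   exactly when its sign vector is componentwise smaller. *)
Definition sign_le o o' : bool :=
  match o, o' with
  | None, _ => true
  | Some _, None => false
  | Some b, Some b' => b == b'
  end.

Lemma sign_le_trans : transitive sign_le.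
Proof. by move=> [[]|] [[]|] [[]|]. Qed.

Lemma sign_of0 : sign_of 0 = None.
Proof. by rewrite /sign_of eqxx. Qed.

Lemma sign_le0 a : sign_le (sign_of a) None = (a == 0).
Proof. by rewrite /sign_of; case: eqP. Qed.

Lemma sign_of_pos_comb k m a b : 0 <= k -> 0 < m ->
  sign_le (sign_of a) (sign_of b) -> sign_of (k * a + m * b) = sign_of b.
Proof.
move=> k0 m0.
by case: (sign_ofP a) => [->|a_sign|a_sign];
  case: (sign_ofP b) => [->|b_sign|b_sign] //= _; rewrite ?mulr0 ?add0r;
  case: sign_ofP => // ?; exfalso; nra.
Qed.

Lemma sign_le_pos_comb k m a b o : 0 <= k -> 0 <= m ->
  sign_le (sign_of a) o -> sign_le (sign_of b) o ->
  sign_le (sign_of (k * a + m * b)) o.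
Proof.
move=> k0 m0.
by case: (sign_ofP a) => [->|a_sign|a_sign];
  case: (sign_ofP b) => [->|b_sign|b_sign];
  case: o => [[]|] //= _ _; rewrite ?mulr0 ?add0r ?addr0;
  case: sign_ofP => // ?; exfalso; nra.
Qed.

Lemma sign_le_opp_eq0 a o :
  sign_le (sign_of a) o -> sign_le (sign_of (- a)) o -> a = 0.
Proof.
by case: (sign_ofP a) => [//||] a_neq0; case: sign_ofP => // Na_sign;
  case: o => [[]|] // _ _; exfalso; lra.
Qed.

Lemma sign_le_side a (b : bool) :
  sign_le (sign_of a) (Some b) || sign_le (sign_of a) (Some (~~ b)).
Proof. by case: (sign_of a) => // c; case: b c => -[]. Qed.

Lemma sign_leN a (b : bool) :
  sign_le (sign_of (- a)) (Some b) = sign_le (sign_of a) (Some (~~ b)).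
Proof.
by case: (sign_ofP a) => ?; case: sign_ofP => ? //; case: b => //; exfalso; lra.
Qed.

Lemma sign_of_ray a b o :
  (forall k, 0 <= k -> sign_of (a + k * b) = o) -> sign_le (sign_of b) o.
Proof.
move=> ray; have ao := ray 0 (lexx 0); rewrite mul0r addr0 in ao.
have [b0|b_neq0] := eqVneq b 0; first by rewrite b0 sign_of0.
have [/ray|] := leP 0 (- a / b).
  rewrite divfK// subrr {1}/sign_of eqxx => o_None.
  have a0 : a = 0 by move: ao; rewrite -o_None; case: sign_ofP.
  by have := ray 1 ler01; rewrite a0 add0r mul1r -o_None => ->.
rewrite -ao mulNr oppr_lt0.
case: (sign_ofP b) => [//|b0|b0]; case: (sign_ofP a) => [->|a0|a0] //.
- by rewrite mul0r ltxx.
- by rewrite pmulr_lgt0 ?invr_gt0// ltNge ltW.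
- by rewrite mul0r ltxx.
- by rewrite nmulr_lgt0 ?invr_lt0// ltNge ltW.
Qed.

Lemma mulr_norm_opp a b : a * b < 0 -> `|b| * a + `|a| * b = 0.
Proof.
move=> ab0; have [a0|a0] := ger0P a; have [b0|b0] := ger0P b.
- by exfalso; nra.
- by ring.
- by ring.
- by exfalso; nra.
Qed.

End Signs.

Lemma dimv_cap_lker (K : fieldType) (V : vectType K) (f : 'Hom(V, K^o))
    (U : {vspace V}) (v : V) :
  v \in U -> f v != 0 -> \dim U = (\dim (U :&: lker f)).+1.
Proof.
move=> vU fv; rewrite -(limg_ker_dim f U) -[RHS]addn1; congr addn.
apply/eqP; rewrite eqn_leq; apply/andP; split.
  by have := dimvS (subvf (f @: U)%VS); rewrite dimvf.
rewrite lt0n dimv_eq0; apply: contraNN fv => /eqP fU.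
by have := memv_img f vU; rewrite fU memv0.
Qed.

Section Cones.
Variables (R : realFieldType) (V : vectType R).
Implicit Types (K : pred V) (L : {vspace V}) (f : 'Hom(V, R^o)) (v w : V).

Definition convex_cone K : Prop :=
  forall a b v w, 0 <= a -> 0 <= b -> K v -> K w -> K (a *: v + b *: w).

Definition lineal K : bool := `[< forall v, K v -> K (- v) >].

Definition cone_cut K f o : pred V :=
  [pred v | K v && sign_le (sign_of (f v : R)) o].

Lemma cone_cut_ker K f o v : K v -> f v = 0 -> cone_cut K f o v.
Proof. by move=> Kv fv; rewrite /cone_cut /= Kv fv sign_of0. Qed.

Lemma lineal_cut0 K f : lineal K -> lineal (cone_cut K f None).
Proof.
move=> /asboolP linK; apply/asboolP => v /andP[/linK KNv].
by rewrite /cone_cut /= KNv !sign_le0 linearN oppr_eq0.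
Qed.

Lemma lineal_cut_side K f b : lineal K ->
  lineal (cone_cut K f (Some b)) = `[< forall v, K v -> f v = 0 >].
Proof.
move=> /asboolP linK; apply/asboolP/asboolP => [linKb v Kv|fK v /andP[Kv _]].
  have fK0 w : K w -> sign_le (sign_of (f w : R)) (Some b) -> f w = 0.
    move=> Kw fw; have /linKb/andP[_] : cone_cut K f (Some b) w.
      by rewrite /cone_cut /= Kw.
    by rewrite linearN; exact: sign_le_opp_eq0.
  have := sign_le_side (f v : R) b; rewrite -sign_leN -linearN.
  move=> /orP[/(fK0 _ Kv)//|/(fK0 _ (linK _ Kv))/eqP].
  by rewrite linearN oppr_eq0 => /eqP.
by apply: cone_cut_ker; [exact: linK | rewrite fK ?linK].
Qed.

Lemma lineal_cut_side0 K f b :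
  lineal (cone_cut K f (Some b)) -> lineal (cone_cut K f None).
Proof.
move=> /asboolP linKb; apply/asboolP => v /andP[Kv].
rewrite sign_le0 => /eqP fv.
have /linKb/andP[KNv _] := cone_cut_ker (Some b) Kv fv.
by apply: cone_cut_ker => //; apply/eqP; rewrite linearN oppr_eq0; exact/eqP.
Qed.

Lemma lineal_cut_sides K f : lineal (cone_cut K f (Some true)) ->
  lineal (cone_cut K f (Some false)) -> lineal K.
Proof.
move=> /asboolP linKpos /asboolP linKneg; apply/asboolP => v Kv.
have /orP[fv|fv] := sign_le_side (f v : R) true.
- have /linKpos/andP[] // : cone_cut K f (Some true) v.
  by rewrite /cone_cut /= Kv.
- have /linKneg/andP[] // : cone_cut K f (Some false) v.
  by rewrite /cone_cut /= Kv.
Qed.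

(* A positive combination of [v] and [w] lies in [K] and in the kernel of [f],
   hence so does its opposite. *)
Lemma convex_cone_opp K f v w : convex_cone K -> lineal (cone_cut K f None) ->
  K v -> K w -> (f v : R) * f w < 0 -> K (- v).
Proof.
move=> coneK /asboolP linK0 Kv Kw fvw.
pose a : R := `|f w|; pose b : R := `|f v|.
have a0 : 0 < a.
  by rewrite normr_gt0; apply: contraTneq fvw => ->; rewrite mulr0 ltxx.
have fab : f (a *: v + b *: w) = 0.
  by rewrite linearD !linearZ; exact: mulr_norm_opp.
have /linK0/andP[KN _] : cone_cut K f None (a *: v + b *: w).
  by apply: cone_cut_ker fab; rewrite coneK ?normr_ge0.
have -> : - v = a^-1 *: - (a *: v + b *: w) + (a^-1 * b) *: w.
  by rewrite scalerN scalerDr opprD !scalerA mulVf ?gt_eqF// scale1r subrK.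
by apply: coneK; rewrite ?mulr_ge0 ?invr_ge0 ?normr_ge0.
Qed.

Lemma not_lineal_side_witness K f b : lineal (cone_cut K f None) ->
  ~~ lineal (cone_cut K f (Some b)) ->
  exists2 v, K v & sign_of (f v : R) = Some b.
Proof.
move=> /asboolP linK0 /asboolPn/existsNP[v /not_implyP[/andP[Kv fv] notKN]].
exists v => //; case: (eqVneq (f v : R) 0) fv => [fv0 _|fv0].
  have /linK0/andP[KNv] := cone_cut_ker None Kv fv0.
  by rewrite sign_le0 => /eqP fNv; case: notKN; exact: cone_cut_ker.
by rewrite /sign_of (negPf fv0) => /eqP ->.
Qed.

Lemma lineal_of_cut0 K f : convex_cone K ->
  lineal (cone_cut K f None) -> ~~ lineal (cone_cut K f (Some true)) ->
  ~~ lineal (cone_cut K f (Some false)) -> lineal K.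
Proof.
move=> coneK linK0 notpos notneg.
have [u Ku fu] := not_lineal_side_witness linK0 notpos.
have [w Kw fw] := not_lineal_side_witness linK0 notneg.
have {}fu : 0 < (f u : R) by move: fu; case: sign_ofP.
have {}fw : (f w : R) < 0 by move: fw; case: sign_ofP.
apply/asboolP => v Kv; have [fv|fv|fv] := ltgtP (f v : R) 0.
- by apply: convex_cone_opp linK0 Kv Ku _; rewrite // nmulr_rlt0.
- by apply: convex_cone_opp linK0 Kv Kw _; rewrite // pmulr_rlt0.
- by have /asboolP/(_ _ (cone_cut_ker None Kv fv))/andP[] := linK0.
Qed.

Lemma not_lineal_cut K f : convex_cone K -> ~~ lineal K ->
  lineal (cone_cut K f None) =
  (lineal (cone_cut K f (Some true)) + lineal (cone_cut K f (Some false)))%N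
  :> nat.
Proof.
move=> coneK /negP notlinK.
have [pos|notpos] := boolP (lineal (cone_cut K f (Some true)));
  have [neg|notneg] := boolP (lineal (cone_cut K f (Some false))).
- by case: notlinK; exact: lineal_cut_sides neg.
- by rewrite (lineal_cut_side0 pos).
- by rewrite (lineal_cut_side0 neg).
have [lin0|//] := boolP (lineal (cone_cut K f None)).
by case: notlinK; exact: lineal_of_cut0 lin0 notpos notneg.
Qed.

(* The Euler characteristic with compact supports of a closed convex cone [K]
   with lineality space [L]. *)
Definition cone_sign K L : int := if lineal K then (-1) ^+ \dim L else 0.

Lemma cone_sign_cut K f L : convex_cone K ->
  (forall v, (v \in L) = K v && K (- v)) ->
  let L0 := (L :&: lker f)%VS in
  cone_sign (cone_cut K f (Some true)) L0 +
  cone_sign (cone_cut K f (Some false)) L0 -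
  cone_sign (cone_cut K f None) L0 = cone_sign K L.
Proof.
move=> coneK LE L0; rewrite /cone_sign; have [linK|notlinK] := boolP (lineal K).
  rewrite lineal_cut0// !lineal_cut_side//; case: asboolP => [fK|/existsNP[v]].
    rewrite addrK; congr (_ ^+ \dim _); apply/capv_idPl/subvP => v.
    by rewrite LE memv_ker => /andP[/fK -> _].
  move=> /not_implyP[Kv /eqP fv]; rewrite !add0r.
  rewrite [in RHS](dimv_cap_lker (v := v) _ fv) ?exprS ?mulN1r// LE Kv.
  by move/asboolP: linK; exact.
move: (not_lineal_cut f coneK notlinK).
by do 3 case: lineal => //=; rewrite ?addr0 ?add0r ?subrr.
Qed.

End Cones.

(** * Cells cut out by sign conditions *)

Lemma dotN (R : realType) (n : nat) (u x : 'rV[R]_n) : dot u (- x) = - dot u x.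
Proof. by rewrite -scaleN1r dotZ mulN1r. Qed.

Lemma dotB (R : realType) (n : nat) (u x y : 'rV[R]_n) :
  dot u (x - y) = dot u x - dot u y.
Proof. by rewrite dotD dotN. Qed.

Lemma dotC (R : realType) (n : nat) (u v : 'rV[R]_n) : dot u v = dot v u.
Proof. by apply: eq_bigr => j _; rewrite mulrC. Qed.

Lemma dot_self_eq0 (R : realType) (n : nat) (v : 'rV[R]_n) :
  dot v v = 0 -> v = 0.
Proof.
move=> /eqP; rewrite psumr_eq0 => [/allP v0|j _]; last exact: sqr_ge0.
apply/rowP => j; have /eqP := v0 j (mem_index_enum j).
by rewrite mxE => /eqP; rewrite mulf_eq0 orbb => /eqP.
Qed.

Lemma dot_linear (R : realType) (n : nat) (u : 'rV[R]_n) :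
  linear (dot u : 'rV[R]_n -> R^o).
Proof. by move=> a x y; rewrite dotD dotZ. Qed.

HB.instance Definition _ (R : realType) (n : nat) (u : 'rV[R]_n) :=
  GRing.isLinear.Build R 'rV[R]_n R^o _ (dot u) (dot_linear u).

Section SetSign.
Variables (I : finType) (T : eqType).
Implicit Types (D : {set I}) (s t : {ffun I -> T}) (i j : I) (o : T).

Definition set_sign s j o : {ffun I -> T} :=
  [ffun i => if i == j then o else s i].

Definition agree_on D s t : bool := [forall i in D, t i == s i].

Lemma agree_onP D s t :
  reflect (forall i, i \in D -> t i = s i) (agree_on D s t).
Proof. by apply: (iffP forall_inP) => st i /st /eqP. Qed.

Lemma agree_onT s t : agree_on [set: I] s t = (t == s).
Proof.
apply/agree_onP/eqP => [st|-> //]; apply/ffunP => i.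
by apply: st; rewrite finset.in_setT.
Qed.

Lemma forall_in_set_sign (p : I -> pred T) D s j o : j \notin D ->
  [forall i in j |: D, p i (set_sign s j o i)] =
  [forall i in D, p i (s i)] && p j o.
Proof.
move=> jD; have iNj i : i \in D -> i == j = false.
  by move=> iD; apply: contraNF jD => /eqP <-.
apply/forall_inP/andP => [p_all|[/forall_inP pD pj] i].
  split; last by have := p_all j (setU11 _ _); rewrite ffunE eqxx.
  by apply/forall_inP => i iD; have := p_all i (setU1r _ iD); rewrite ffunE iNj.
by rewrite !inE ffunE => /orP[/eqP ->|iD]; rewrite ?eqxx// iNj// pD.
Qed.

Lemma agree_onU1 D s t j o : j \notin D ->
  agree_on (j |: D) (set_sign s j o) t = agree_on D s t && (t j == o).
Proof. exact: (forall_in_set_sign (fun i o => t i == o)). Qed.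

End SetSign.

Section SignConditions.
Variables (R : realType) (n : nat) (A : arrangement R n).
Local Notation I := 'I_(nhyp A).
Implicit Types (B D : {set I}) (s t : {ffun I -> option bool}) (i j : I)
  (o : option bool) (b : bool) (x y v w : 'rV[R]_n) (e : R).

Definition level i x : R := dot (normal i) x - offset i.

Lemma levelD i x v : level i (x + v) = level i x + dot (normal i) v.
Proof. by rewrite /level dotD addrAC. Qed.

Lemma level_segment i x y e :
  level i (x + e *: (y - x)) = (1 - e) * level i x + e * level i y.
Proof. by rewrite levelD dotZ dotB /level; ring. Qed.

Definition sign_vector x : {ffun I -> option bool} :=
  [ffun i => sign_of (level i x)].

Lemma open_sideP i o x : open_side i o x <-> sign_of (level i x) = o.
Proof.
rewrite /level; case: o => [[]|]; rewrite /= /hyperplane /=;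
  split; case: sign_ofP => // *; (exfalso; lra) || lra.
Qed.

Lemma closed_side_sign_le i o x :
  closed_side i o x -> sign_le (sign_of (level i x)) o.
Proof.
rewrite /level; case: o => [[]|]; rewrite /= /hyperplane /=;
  case: sign_ofP => //= *; exfalso; lra.
Qed.

Lemma cellP s x : cell s x <-> sign_vector x = s.
Proof.
split=> [sx|<- i _]; last by apply/open_sideP; rewrite ffunE.
by apply/ffunP => i; rewrite ffunE; apply/open_sideP/sx.
Qed.

(* A sign condition is a pair [(D, s)]: the values of [s] outside [D] are
   irrelevant. *)
Definition sat D s x : bool := agree_on D s (sign_vector x).

Definition satisfiable D s : bool := `[< exists x, sat D s x >].

Lemma sat_sign_of D s x i : sat D s x -> i \in D -> sign_of (level i x) = s i.
Proof. by move=> /agree_onP sx /sx; rewrite ffunE. Qed.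

Definition recession D s : pred 'rV[R]_n :=
  [pred v | [forall i in D, sign_le (sign_of (dot (normal i) v)) (s i)]].

Lemma recession_convex_cone D s : convex_cone (recession D s).
Proof.
move=> a b v w a0 b0 /forall_inP rv /forall_inP rw; apply/forall_inP => i iD.
by rewrite dotD !dotZ; apply: sign_le_pos_comb; auto.
Qed.

Definition normal_form i : 'Hom('rV[R]_n, R^o) := linfun (dot (normal i)).

Lemma recessionU1 D s j o : j \notin D ->
  recession (j |: D) (set_sign s j o) =
  cone_cut (recession D s) (normal_form j) o.
Proof.
move=> jD; apply/funext => v; rewrite /cone_cut /= lfunE /=.
exact: (forall_in_set_sign (fun i => sign_le (sign_of (dot (normal i) v)))).
Qed.

Definition dirspace B : {vspace 'rV[R]_n} :=
  (\bigcap_(i in B) lker (normal_form i))%VS.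

Lemma dirspaceP B v :
  reflect (forall i, i \in B -> dot (normal i) v = 0) (v \in dirspace B).
Proof.
apply: (iffP subv_bigcapP) => [Bv i iB|Bv i iB].
  by have := Bv i iB; rewrite -memvE memv_ker lfunE => /eqP.
by rewrite -memvE memv_ker lfunE; apply/eqP/Bv.
Qed.

Lemma dirspaceU1 j B :
  dirspace (j |: B) = (dirspace B :&: lker (normal_form j))%VS.
Proof.
apply/vspaceP => v; rewrite memv_cap memv_ker lfunE.
apply/dirspaceP/andP => [Bv|[/dirspaceP Bv /eqP jv] i].
  split; last by apply/eqP/Bv; rewrite setU11.
  by apply/dirspaceP => i iB; apply: Bv; rewrite setU1r.
by rewrite !inE => /orP[/eqP ->|/Bv].
Qed.

Lemma dirspaceS B D : B \subset D -> (dirspace D <= dirspace B)%VS.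
Proof.
move=> /fintype.subsetP BD; apply/subvP => v /dirspaceP Dv.
by apply/dirspaceP => i /BD/Dv.
Qed.

Lemma mem_dirspace D s v :
  (v \in dirspace D) = recession D s v && recession D s (- v).
Proof.
apply/dirspaceP/andP => [Dv|[/forall_inP rv /forall_inP rNv] i iD].
  by split; apply/forall_inP => i iD; rewrite ?dotN Dv// ?oppr0 sign_of0.
have := rNv i iD; rewrite dotN; exact: sign_le_opp_eq0 (rv i iD).
Qed.

Definition zeros D s : {set I} := [set i in D | s i == None]%SET.

Lemma zerosU1 D s j o : j \notin D ->
  zeros (j |: D) (set_sign s j o) =
  if o == None then j |: zeros D s else zeros D s.
Proof.
move=> jD; apply/setP => i; rewrite !inE ffunE.
case: (eqVneq i j) => [->|ij] /=; case: o => [b|] /=; rewrite !inE ?eqxx//.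
- by rewrite (negPf jD).
- by rewrite (negPf ij).
Qed.

Lemma sat_sub_dirspace D s x y : sat D s x -> sat D s y ->
  y - x \in dirspace (zeros D s).
Proof.
move=> sx sy; apply/dirspaceP => i; rewrite inE => /andP[iD /eqP si].
have lev0 z : sat D s z -> level i z = 0.
  by move=> /sat_sign_of-/(_ _ iD); rewrite si; case: sign_ofP.
have := levelD i x (y - x); rewrite addrC subrK lev0// lev0// add0r.
by move=> <-.
Qed.

Lemma sat_recession D s x v : sat D s x -> recession D s v -> sat D s (x + v).
Proof.
move=> sx /forall_inP rv; apply/agree_onP => i iD.
rewrite ffunE levelD addrC -[dot _ _]mul1r -[level _ _]mul1r.
by rewrite sign_of_pos_comb ?(sat_sign_of sx)// rv.
Qed.

Lemma sat_segment D s t x y e :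
  (forall i, i \in D -> sign_le (s i) (t i)) -> sat D s x -> sat D t y ->
  0 < e -> e <= 1 -> sat D t (x + e *: (y - x)).
Proof.
move=> st sx ty e0 e1; apply/agree_onP => i iD.
rewrite ffunE level_segment sign_of_pos_comb ?subr_ge0 ?(sat_sign_of ty)//.
by rewrite (sat_sign_of sx) ?st.
Qed.

Local Open Scope classical_set_scope.

Lemma cvg_line_right x v : x + e *: v @[e --> (0 : R)^'+] --> x.
Proof.
suff : x + e *: v @[e --> (0 : R)^'+] --> x + 0 *: v by rewrite scale0r addr0.
apply: cvgD; first exact: cvg_cst.
by apply: cvgZr_tmp; apply: cvg_at_right_filter; exact: cvg_id.
Qed.

Lemma open_open_side i b : open (open_side i (Some b)).
Proof.
have cont := @dot_continuous R n (normal i).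
case: b => /=.
- by apply: (@open_comp _ _ (dot (normal i)) [set y | offset i < y]);
    [move=> *; exact: cont | exact: open_gt].
- by apply: (@open_comp _ _ (dot (normal i)) [set y | y < offset i]);
    [move=> *; exact: cont | exact: open_lt].
Qed.

Lemma sat_relatively_open D s x v : sat D s x -> v \in dirspace (zeros D s) ->
  exists2 e, 0 < e & sat D s (x + e *: v).
Proof.
move=> sx /dirspaceP v0; suff : \forall e \near (0 : R)^'+,
    forall i, i \in D -> sign_of (level i (x + e *: v)) = s i.
  move=> near_s.
  have : \forall e \near (0 : R)^'+, 0 < e /\ sat D s (x + e *: v).
    near=> e; split; first by near: e; exact: nbhs_right_gt.
    by apply/agree_onP => i iD; rewrite ffunE; move: i iD; near: e.
  by move=> /filter_ex[e []]; exists e.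
apply: filter_forall => i; have [iD|iD] := boolP (i \in D); last by near=> e.
have := sat_sign_of sx iD; case E : (s i) => [b|] xi.
  near=> e => _; apply/open_sideP; near: e; apply: (@cvg_line_right x v).
  by apply: open_nbhs_nbhs; split; [exact: open_open_side | exact/open_sideP].
near=> e => _; rewrite levelD dotZ v0 ?mulr0 ?addr0 ?xi//.
by rewrite inE iD E.
Unshelve. all: by end_near. Qed.

Local Close Scope classical_set_scope.

Definition touches D s j o : bool :=
  `[< exists2 x, sat D s x & sign_of (level j x) = o >].

Lemma satisfiableU1 D s j o : j \notin D ->
  satisfiable (j |: D) (set_sign s j o) = touches D s j o.
Proof.
move=> jD; apply/asboolP/asboolP => -[x].
  by rewrite /sat agree_onU1// ffunE => /andP[sx /eqP]; exists x.
by move=> sx xj; exists x; rewrite /sat agree_onU1// ffunE xj eqxx andbT.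
Qed.

Lemma touches_opp D s j b :
  touches D s j None -> touches D s j (Some b) -> touches D s j (Some (~~ b)).
Proof.
move=> /asboolP[x sx xj] /asboolP[y sy yj].
have [e e0 se] := sat_relatively_open sx (sat_sub_dirspace sy sx).
apply/asboolP; exists (x + e *: (x - y)) => //.
rewrite -[e *: _]opprK -scalerN opprB -scaleNr level_segment.
move: xj yj; case: sign_ofP => // -> _; rewrite mulr0 add0r.
by case: sign_ofP => // yj [<-]; case: sign_ofP => // ?; exfalso; nra.
Qed.

Lemma touches_hyperplane D s j :
  touches D s j (Some true) -> touches D s j (Some false) -> touches D s j None.
Proof.
move=> /asboolP[x sx xj] /asboolP[y sy yj].
have {}xj : 0 < level j x by move: xj; case: sign_ofP.
have {}yj : level j y < 0 by move: yj; case: sign_ofP.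
have xy : 0 < level j x - level j y by lra.
apply/asboolP; exists (x + (level j x / (level j x - level j y)) *: (y - x)).
  apply: sat_segment sx sy _ _ => [i _||]; first by case: (s i) => /=.
  - by rewrite divr_gt0.
  - by rewrite ler_pdivrMr// mul1r; lra.
rewrite level_segment -[RHS](@sign_of0 R); congr sign_of.
by field; exact: lt0r_neq0.
Qed.

Variant split_spec D s j : Prop :=
| SplitCrossing of (forall o, touches D s j o)
| SplitOneSided o of (forall x, sat D s x -> sign_of (level j x) = o).

Lemma hyperplane_splitP D s j : split_spec D s j.
Proof.
have [[o only]|crossed] :=
    pselect (exists o, forall x, sat D s x -> sign_of (level j x) = o).
  exact: SplitOneSided only.
have another o : exists2 o', touches D s j o' & o' <> o.
  move/forallNP: crossed => /(_ o)/existsNP[x /not_implyP[sx xo]].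
  by exists (sign_of (level j x)) => //; apply/asboolP; exists x.
have [[b|//] tb _] := another None.
have [tN|tNb] : touches D s j None \/ touches D s j (Some (~~ b)).
- have [[c|] tc cb] := another (Some b); [right|by left].
  by case: b c cb tc {tb} => -[].
- by apply: SplitCrossing => -[c|//]; case: b c tb (touches_opp tN tb) => -[].
- have tN : touches D s j None.
    by case: b tb tNb => *; exact: touches_hyperplane.
  by apply: SplitCrossing => -[c|//]; case: b c tb tNb => -[].
Qed.

End SignConditions.

(** * Additive functions of cells *)

Lemma big_option_bool (V : nmodType) (f : option bool -> V) :
  \sum_o f o = f None + f (Some true) + f (Some false).
Proof.
rewrite (bigD1 None)//= (bigD1 (Some true))//= (bigD1 (Some false))//=.
by rewrite big_pred0 ?addr0 ?addrA// => -[[]|].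
Qed.

Section AdditiveFunctions.
Variables (R : realType) (n : nat) (A : arrangement R n).
Local Notation I := 'I_(nhyp A).
Implicit Types (D : {set I}) (s : {ffun I -> option bool}) (j : I)
  (o : option bool) (x v : 'rV[R]_n).

Definition split_additive (V : nmodType)
    (phi : {set I} -> {ffun I -> option bool} -> V) : Prop :=
  forall D s j, j \notin D -> satisfiable D s ->
  \sum_(o | satisfiable (j |: D) (set_sign s j o))
     phi (j |: D) (set_sign s j o) = phi D s.

Definition cell_dim D s : nat := \dim (dirspace (zeros D s)).

Section OneSided.
Variables (D : {set I}) (s : {ffun I -> option bool}) (j : I) (o : option bool).
Hypotheses (jD : j \notin D) (sD : satisfiable D s).
Hypothesis only_o : forall x, sat D s x -> sign_of (level j x) = o.

Lemma one_sided_recession v :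
  recession D s v -> sign_le (sign_of (dot (normal j) v)) o.
Proof.
move=> rv; have /asboolP[x sx] := sD.
apply: (@sign_of_ray _ (level j x)) => k k0; rewrite -dotZ -levelD.
apply/only_o/sat_recession => //; rewrite -[k *: v]addr0 -(scale0r v).
exact: recession_convex_cone.
Qed.

Lemma recessionU1_one_sided :
  recession (j |: D) (set_sign s j o) = recession D s.
Proof.
rewrite recessionU1//; apply/funext => v; rewrite /cone_cut /= lfunE /=.
by case: (boolP (recession D s v)) => //= /one_sided_recession ->.
Qed.

Lemma dirspaceU1_one_sided : dirspace (j |: D) = dirspace D.
Proof.
apply/vspaceP => v.
rewrite (mem_dirspace _ (set_sign s j o)) recessionU1_one_sided.
by rewrite (mem_dirspace _ s).
Qed.

Lemma cell_dimU1_one_sided : cell_dim (j |: D) (set_sign s j o) = cell_dim D s.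
Proof.
rewrite /cell_dim zerosU1//; case: eqP => // o0; rewrite dirspaceU1.
congr (\dim _); apply/capv_idPl/subvP => v vz; rewrite memv_ker lfunE /=.
have /asboolP[x sx] := sD; have [e e0 se] := sat_relatively_open sx vz.
have := only_o se; rewrite levelD dotZ; have := only_o sx; rewrite o0.
case: sign_ofP => // -> _; rewrite add0r; case: sign_ofP => // /eqP.
by rewrite mulf_eq0 (gt_eqF e0).
Qed.

End OneSided.

Section Crossing.
Variables (D : {set I}) (s : {ffun I -> option bool}) (j : I).
Hypotheses (jD : j \notin D) (crossing : forall o, touches D s j o).

Lemma crossing_direction :
  exists2 v, v \in dirspace (zeros D s) & normal_form j v != 0.
Proof.
have /asboolP[x sx] := crossing None; case: sign_ofP => // xj _.
have /asboolP[y sy] := crossing (Some true); case: sign_ofP => // yj _.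
exists (y - x); first exact: sat_sub_dirspace sx sy.
have := levelD j x (y - x); rewrite addrC subrK xj add0r lfunE /= => <-.
exact: lt0r_neq0.
Qed.

Lemma cell_dimU1_crossing0 :
  cell_dim D s = (cell_dim (j |: D) (set_sign s j None)).+1.
Proof.
have [v vz vj] := crossing_direction.
by rewrite /cell_dim zerosU1//= dirspaceU1 (dimv_cap_lker vz vj).
Qed.

Lemma cell_dimU1_side b :
  cell_dim (j |: D) (set_sign s j (Some b)) = cell_dim D s.
Proof. by rewrite /cell_dim zerosU1. Qed.

End Crossing.

Lemma split_additiveI (V : nmodType)
    (phi : {set I} -> {ffun I -> option bool} -> V) :
  (forall D s j, j \notin D -> (forall o, touches D s j o) ->
     \sum_o phi (j |: D) (set_sign s j o) = phi D s) ->
  (forall D s j o, j \notin D -> satisfiable D s ->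
     (forall x, sat D s x -> sign_of (level j x) = o) ->
     phi (j |: D) (set_sign s j o) = phi D s) ->
  split_additive phi.
Proof.
move=> phi_crossing phi_one_sided D s j jD sD.
under eq_bigl do rewrite satisfiableU1//.
have [all_o|o only_o] := hyperplane_splitP D s j.
  by rewrite (eq_bigl xpredT) ?phi_crossing// => o; rewrite all_o.
rewrite (big_pred1 o) ?(phi_one_sided _ _ _ o)// => o' /=.
apply/asboolP/eqP => [[x sx <-]|->]; first by rewrite only_o.
by have /asboolP[x sx] := sD; exists x => //; exact: only_o.
Qed.

Definition euler_sign D s : int := (-1) ^+ cell_dim D s.

Lemma euler_sign_additive : split_additive euler_sign.
Proof.
apply: split_additiveI => [D s j jD all_o|D s j o jD sD only_o]; last first.
  by rewrite /euler_sign (cell_dimU1_one_sided jD sD only_o).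
rewrite big_option_bool /euler_sign !cell_dimU1_side//.
by rewrite (cell_dimU1_crossing0 jD all_o) exprS mulN1r subrr add0r.
Qed.

(* When [D] is the whole of an essential arrangement, the Euler sign of a
   bounded cell and [0] for an unbounded one. *)
Definition bounded_sign D s : int :=
  euler_sign D s * cone_sign (recession D s) (dirspace D).

Lemma bounded_sign_additive : split_additive bounded_sign.
Proof.
apply: split_additiveI => [D s j jD all_o|D s j o jD sD only_o]; last first.
  rewrite /bounded_sign /euler_sign (cell_dimU1_one_sided jD sD only_o).
  rewrite (recessionU1_one_sided jD sD only_o).
  by rewrite (dirspaceU1_one_sided jD sD only_o).
rewrite /bounded_sign big_option_bool /euler_sign !cell_dimU1_side//.
rewrite -(cone_sign_cut (normal_form j) (@recession_convex_cone R n A D s)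
  (mem_dirspace D s)) dirspaceU1 !recessionU1//.
rewrite (cell_dimU1_crossing0 jD all_o) exprS mulN1r !mulNr.
by rewrite -addrA -opprD -mulrDr mulrBr opprB.
Qed.

End AdditiveFunctions.

(** * Bounded cells *)

Section Boundedness.
Variable R : realType.

Local Open Scope classical_set_scope.

Lemma bounded_set_ray_eq0 (V : normedModType R) (S : set V) (x v : V) :
  bounded_set S -> (forall k, 0 <= k -> S (x + k *: v)) -> v = 0.
Proof.
move=> [M [_ bM]] ray; apply/eqP; apply: contrapT => /negP v0.
have nv : 0 < `|v| by rewrite normr_gt0.
pose M' := `|M| + 1; pose k := (M' + `|x| + 1) / `|v|.
have MM' : M < M' by rewrite (le_lt_trans (ler_norm M))// ltrDl.
have k0 : 0 <= k by rewrite divr_ge0 ?addr_ge0 ?normr_ge0.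
have := bM M' MM' _ (ray k k0); rewrite /= leNgt => /negP; apply.
have : `|k *: v| <= `|x + k *: v| + `|x|.
  by rewrite -{1}[k *: v](addrK x) [k *: v + x]addrC ler_normB.
by rewrite normrZ ger0_norm// /k divfK ?gt_eqF//; lra.
Qed.

Lemma pos_homogeneous_lower_bound (n : nat) (g : 'rV[R]_n -> R) :
  continuous g -> (forall k v, 0 <= k -> g (k *: v) = k * g v) ->
  (forall v, v != 0 -> 0 < g v) ->
  exists2 c, 0 < c & forall v, c * `|v| <= g v.
Proof.
move=> cg gZ g_gt0; pose S := [set v : 'rV[R]_n | `|v| = 1].
have normalize v : v != 0 -> S (`|v|^-1 *: v).
  by move=> v0; rewrite /S /= normrZ normfV normr_id mulVf// normr_eq0.
have g0 : g 0 = 0 by rewrite -(scale0r 0) gZ// mul0r.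
have [S0|S0] := pselect (S !=set0); last first.
  exists 1 => // v; have [->|/normalize v1] := eqVneq v 0.
    by rewrite normr0 mulr0 g0.
  by case: S0; eexists; exact: v1.
have cS : compact S.
  apply: bounded_closed_compact.
    by exists 1; split; [exact: real1|move=> M M1 v /= ->; exact: ltW].
  apply: (@preimage_closed _ _ (fun v : 'rV[R]_n => `|v|) [set y | y = 1]).
    by move=> v _; exact: norm_continuous.
  exact: closed_eq.
have [u Su gmin] := @EVT_min_rV R n g S S0 cS (continuous_subspaceT cg).
exists (g u) => [|v].
  apply: g_gt0; apply/eqP => u0; move: Su.
  by rewrite inE /S /= u0 normr0 => /esym/eqP; rewrite oner_eq0.
have [->|v0] := eqVneq v 0; first by rewrite normr0 mulr0 g0.
rewrite -[v in leRHS](scalerKV (a := `|v|)) ?normr_eq0// gZ// mulrC.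
by rewrite ler_wpM2l// gmin// inE; exact: normalize.
Qed.

End Boundedness.

Section SignGap.
Variable R : realType.
Implicit Types (o : option bool) (a b k : R).

(* Proportional, for each [o], to the distance from [a] to the closed set of
   the [b] such that [sign_le (sign_of b) o]. *)
Definition sign_gap o a : R :=
  `|a| - (if o is Some b then if b then 1 else -1 else 0) * a.

Lemma sign_gap_ge0 o a : 0 <= sign_gap o a.
Proof. by rewrite /sign_gap; case: o => [[]|]; have [?|?] := ger0P a; lra. Qed.

Lemma sign_gap_eq0 o a : sign_gap o a = 0 -> sign_le (sign_of a) o.
Proof.
rewrite /sign_gap; case: sign_ofP => [//|a0|a0]; case: o => [[]|] //=;
  rewrite ?(gtr0_norm a0) ?(ltr0_norm a0) => ?; exfalso; lra.
Qed.

Lemma sign_gapZ o k a : 0 <= k -> sign_gap o (k * a) = k * sign_gap o a.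
Proof. by move=> k0; rewrite /sign_gap normrM ger0_norm//; ring. Qed.

Lemma sign_gapB_le a b : sign_gap (sign_of a) (a - b) <= 2 * `|b|.
Proof.
rewrite /sign_gap; case: sign_ofP => ?; have [?|?] := ger0P b;
  have [?|?] := ger0P (a - b); lra.
Qed.

Lemma continuous_sign_gap o : continuous (sign_gap o).
Proof.
move=> a; apply: (@continuousB R R R Num.norm ( *%R _)).
  exact: norm_continuous.
exact: mulrl_continuous.
Qed.

End SignGap.

Section BoundedCells.
Variables (R : realType) (n : nat) (A : arrangement R n).
Local Notation I := 'I_(nhyp A).
Implicit Types (D : {set I}) (s : {ffun I -> option bool}) (i : I)
  (x v : 'rV[R]_n) (k : R).

Definition recession_gap D s v : R :=
  \sum_(i in D) sign_gap (s i) (dot (normal i) v).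

Lemma recession_gapZ D s k v : 0 <= k ->
  recession_gap D s (k *: v) = k * recession_gap D s v.
Proof.
by move=> k0; rewrite mulr_sumr; apply: eq_bigr => i _; rewrite dotZ sign_gapZ.
Qed.

Lemma recession_gap_gt0 D s v : ~~ recession D s v -> 0 < recession_gap D s v.
Proof.
apply: contraNT; rewrite -leNgt => gap_le0; apply/forall_inP => i iD.
have gap_ge0 j : j \in D -> 0 <= sign_gap (s j) (dot (normal j) v).
  by move=> _; exact: sign_gap_ge0.
have : recession_gap D s v == 0 by rewrite eq_le gap_le0 sumr_ge0.
rewrite psumr_eq0// => /allP/(_ i (mem_index_enum i)).
by rewrite iD => /eqP/sign_gap_eq0.
Qed.

Local Open Scope classical_set_scope.

Lemma continuous_recession_gap D s : continuous (recession_gap D s).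
Proof.
apply: continuous_big => [|i _]; first exact: add_continuous.
move=> v; apply: (@continuous_comp _ _ _ (dot (normal i)) (sign_gap (s i))).
  exact: dot_continuous.
exact: continuous_sign_gap.
Qed.

Lemma bounded_cellP D s : satisfiable D s ->
  bounded_set [set x | sat D s x] <-> (forall v, recession D s v -> v = 0).
Proof.
move=> /asboolP[x0 sx0]; split=> [bD v rv|rec0].
  apply: (bounded_set_ray_eq0 (x := x0) bD) => k k0; apply: sat_recession => //.
  rewrite -[k *: v]addr0 -(scale0r v); exact: recession_convex_cone.
have [||v v0|c c0 gap_ge] :=
    @pos_homogeneous_lower_bound R n (recession_gap D s).
- exact: continuous_recession_gap.
- by move=> *; exact: recession_gapZ.
- by apply: recession_gap_gt0; apply: contraNN v0 => /rec0 ->.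
pose K : R := \sum_(i in D) 2 * `|level i x0|.
exists (`|x0| + K / c); split; first exact: num_real.
move=> M MM x sx /=; apply: le_trans (ltW MM).
rewrite -[x in `|x|](subrK x0) addrC (le_trans (ler_normD _ _))// lerD2l.
rewrite ler_pdivlMr// mulrC (le_trans (gap_ge _))// ler_sum// => i iD.
rewrite -(sat_sign_of sx iD).
have -> : dot (normal i) (x - x0) = level i x - level i x0.
  by rewrite dotB /level; ring.
exact: sign_gapB_le.
Qed.

End BoundedCells.

(** * Faces *)

Section Faces.
Variables (R : realType) (n : nat) (A : arrangement R n).
Local Notation I := 'I_(nhyp A).
Local Notation IT := [set: I]%SET.
Implicit Types (D : {set I}) (s : {ffun I -> option bool}) (i j : I)
  (x y v : 'rV[R]_n) (F G : face A).

Definition signs F : {ffun I -> option bool} := projT1 (cid (faceP F).1).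

Lemma mem_face F x : fsval F x <-> sign_vector A x = signs F.
Proof. by rewrite -cellP /signs; case: cid => s /= ->. Qed.

Lemma face_point F : exists x, sign_vector A x = signs F.
Proof. by have [_ [x /mem_face]] := faceP F; exists x. Qed.

Lemma sat_signs F x : sat IT (signs F) x <-> fsval F x.
Proof. by rewrite mem_face /sat agree_onT; split=> /eqP. Qed.

Lemma satisfiable_signs F : satisfiable IT (signs F).
Proof.
have [x Fx] := face_point F; apply/asboolP; exists x.
exact/sat_signs/mem_face.
Qed.

Lemma sign_vector_face x : exists F, signs F = sign_vector A x.
Proof.
have cx : cell (A := A) (sign_vector A x) x by apply/cellP.
have Fx : cell (A := A) (sign_vector A x) \in faces A.
  rewrite !inE; apply/andP; split; first by apply/set0P; exists x.
  by apply/imfsetP; exists (sign_vector A x).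
by exists [` Fx]%fset; apply/esym/mem_face.
Qed.

Lemma signs_inj : injective signs.
Proof.
move=> F G FG; apply/val_inj/seteqP.
by split=> x /mem_face xE; apply/mem_face; rewrite xE FG.
Qed.

Lemma agree_on_satisfiable D s F : agree_on D s (signs F) -> satisfiable D s.
Proof. by have [x <-] := face_point F => Ds; apply/asboolP; exists x. Qed.

Lemma sum_faces (V : nmodType) (phi : {set I} -> {ffun I -> option bool} -> V)
    D s : split_additive phi -> satisfiable D s ->
  \sum_(F | agree_on D s (signs F)) phi IT (signs F) = phi D s.
Proof.
move=> phi_add; have [m] := ubnP #|~: D|.
elim: m D s => // m IHm D s; rewrite ltnS => card_D sD.
have [/eqP DT|/set0Pn[j]] := boolP (~: D == finset.set0).
  have {DT}DT : D = IT by rewrite -(finset.setCK D) DT finset.setC0.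
  rewrite DT in sD *; have /asboolP[x] := sD; rewrite /sat agree_onT => /eqP xs.
  have [F Fx] := sign_vector_face x; rewrite (big_pred1 F) ?Fx ?xs// => G /=.
  by rewrite agree_onT -(inj_eq signs_inj) Fx xs.
rewrite inE => jD; rewrite -(phi_add D s j jD sD).
rewrite (partition_big (fun F => signs F j)
  (fun o => satisfiable (j |: D) (set_sign s j o))) /= => [|F FD]; last first.
  by apply: (@agree_on_satisfiable _ _ F); rewrite agree_onU1// FD eqxx.
apply: eq_bigr => o so; rewrite -IHm//.
  by apply: eq_bigl => F; rewrite agree_onU1.
by apply: leq_trans card_D; rewrite finset.setCU finset.setIC -finset.setDE
  [in leqRHS](cardsD1 j) inE jD.
Qed.

Local Open Scope classical_set_scope.

Lemma face_leE F G : (F <= G)%O = [forall i, sign_le (signs F i) (signs G i)].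
Proof.
have -> : (F <= G)%O = `[< fsval F `<=` closure (fsval G) >] by [].
apply/asboolP/forallP => [FG i|FG x Fx].
  have [x Fx] := face_point F; rewrite -Fx ffunE.
  apply/closed_side_sign_le/closure_cell.
  suff <- : fsval G = cell (signs G) by exact/FG/mem_face.
  by apply/seteqP; split=> y; rewrite mem_face cellP.
have [y Gy] := face_point G; move=> B Bx.
have : \forall e \near (0 : R)^'+, (fsval G `&` B) (x + e *: (y - x)).
  near=> e; split; last by near: e; exact: cvg_line_right Bx.
  apply/sat_signs/(@sat_segment _ _ _ _ (signs F)).
  - by move=> i _; exact: FG.
  - exact/sat_signs.
  - exact/sat_signs/mem_face.
  - by near: e; exact: nbhs_right_gt.
  - by near: e; exact: nbhs_right_le.
by move=> /filter_ex[e]; exists (x + e *: (y - x)).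
Unshelve. all: by end_near. Qed.

Definition face_bounded F : bool := `[< bounded_set (fsval F) >].

Lemma face_boundedP F :
  reflect (forall v, recession IT (signs F) v -> v = 0) (face_bounded F).
Proof.
have -> : face_bounded F = `[< bounded_set [set x | sat IT (signs F) x] >].
  by congr (asbool (bounded_set _)); apply/seteqP; split=> x /= /sat_signs.
apply: (iffP (asboolP _)); by move/(bounded_cellP (satisfiable_signs F)).
Qed.

Lemma face_bounded_le F G : (F <= G)%O -> face_bounded G -> face_bounded F.
Proof.
rewrite face_leE => /forallP FG /face_boundedP rec0.
apply/face_boundedP => v /forall_inP rv; apply: rec0.
by apply/forall_inP => i iT; apply: sign_le_trans (FG i); exact: rv.
Qed.

End Faces.

(** * Flats and alternating sums over faces *)

Section Flats.
Variables (R : realType) (n : nat) (A : arrangement R n).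
Local Notation I := 'I_(nhyp A).
Local Notation IT := [set: I]%SET.
Local Notation empty := (empty_flat A).
Implicit Types (B D : {set I}) (s : {ffun I -> option bool}) (i : I)
  (p q v : 'rV[R]_n) (F G : face A) (X Y : int_lattice A)
  (x y : int_lattice0 A).

Lemma flat_dirspace B p q : flat B p -> flat B q <-> q - p \in dirspace B.
Proof.
move=> Bp; split=> [Bq|/dirspaceP Bqp i /= iB].
  apply/dirspaceP => i iB; move: (Bp i iB) (Bq i iB).
  by rewrite /hyperplane /= dotB => -> ->; rewrite subrr.
by move: (Bp i iB) (Bqp i iB); rewrite /hyperplane /= dotB => -> /subr0_eq.
Qed.

Lemma affine_dim_flat B p : flat B p -> affine_dim (flat B) = \dim (dirspace B).
Proof.
move=> Bp; rewrite /affine_dim; set dirs := [set V | _]%classic.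
have [q BE] : dirs (xget 0%VS dirs).
  apply: xgetPex; exists (dirspace B), p; apply/seteqP.
  by split=> q /(flat_dirspace _ Bp).
have Bq : flat B q by rewrite BE /= subrr mem0v.
congr (\dim _); apply/vspaceP => v; apply/idP/idP => [v_dir|vB].
  suff /(flat_dirspace _ Bq) : flat B (q + v) by rewrite addrC addKr.
  by rewrite BE /= addrC addKr.
have : flat B (q + v) by apply/(flat_dirspace _ Bq); rewrite addrC addKr.
by rewrite BE /= addrC addKr.
Qed.

Definition support X : {set I} :=
  [set i | `[< (fsval X `<=` hyperplane i)%classic >]]%SET.

Lemma mem_supportP X i :
  reflect (fsval X `<=` hyperplane i)%classic (i \in support X).
Proof. by rewrite inE; exact: asboolP. Qed.

Lemma int_lattice_leE X Y : (X <= Y)%O = `[< (fsval Y `<=` fsval X)%classic >].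
Proof. by []. Qed.

Lemma le_empty_flat X : (X <= empty)%O.
Proof. by rewrite int_lattice_leE; apply/asboolP. Qed.

Lemma flat_neq_le X Y : (X <= Y)%O -> Y != empty -> X != empty.
Proof.
by move=> XY; apply: contraNneq => X0; rewrite eq_le le_empty_flat -X0.
Qed.

Lemma fsval_support X : X != empty -> fsval X = flat (support X).
Proof.
move=> X0; apply/seteqP; split=> [p Xp i /mem_supportP|p supp_p].
  exact.
have := fsvalP X; rewrite !inE => /orP[/eqP XE|/imfsetP[B _ XB]].
  by case/eqP: X0; apply: val_inj.
rewrite XB => i /= iB; apply: supp_p; apply/mem_supportP; rewrite XB.
by move=> q; exact.
Qed.

Lemma flat_point X : X != empty -> exists p, fsval X p.
Proof.
move=> X0; apply: contrapT => /forallNP noX; case/eqP: X0.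
by apply/val_inj/seteqP; split=> // p /noX.
Qed.

Lemma le_support X Y : X != empty -> (X <= Y)%O = (support X \subset support Y).
Proof.
move=> X0; rewrite int_lattice_leE.
apply/asboolP/fintype.subsetP => [YX i|XY p Yp].
  by move/mem_supportP => Xi; apply/mem_supportP => p /YX/Xi.
by rewrite fsval_support// => i /XY/mem_supportP; exact.
Qed.

Lemma int_rank_support X : X != empty ->
  int_rank X = (n - \dim (dirspace (support X)))%N.
Proof.
move=> X0; have [p] := flat_point X0; rewrite /int_rank (negPf X0).
by rewrite fsval_support// => /affine_dim_flat ->.
Qed.

Lemma dim_dirspace_le B : (\dim (dirspace B) <= n)%N.
Proof. by have := dimvS (subvf (dirspace B)); rewrite dimvf /dim /= mul1n. Qed.

Lemma int_rank0_le x y : (x <= y)%O -> (int_rank0 x <= int_rank0 y)%N.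
Proof.
case: x y => [|X] [|Y] //= XY; rewrite ltnS.
have [->|Y0] := eqVneq Y empty.
  rewrite {2}/int_rank eqxx /int_rank; case: ifP => // _.
  by rewrite (leq_trans (leq_subr _ _)).
rewrite !int_rank_support ?(flat_neq_le XY)// leq_sub2l// dimvS// dirspaceS//.
by rewrite -le_support ?(flat_neq_le XY).
Qed.

Definition rank_sign x : int := (-1) ^+ int_rank0 x.

Lemma rank_sign_sqr x : rank_sign x * rank_sign x = 1.
Proof. by rewrite -expr2 sqrr_sign. Qed.

Lemma rank_signB x y : (x <= y)%O ->
  (-1) ^+ (int_rank0 y - int_rank0 x) = rank_sign x * rank_sign y.
Proof.
move=> /int_rank0_le xy.
by rewrite /rank_sign -[in RHS](subnK xy) exprD mulrCA rank_sign_sqr mulr1.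
Qed.

Lemma rank_sign_flat X : X != empty ->
  rank_sign (BElt X) = (-1) ^+ n.+1 * (-1) ^+ \dim (dirspace (support X)).
Proof.
move=> /int_rank_support rankX; rewrite /rank_sign /= rankX.
have dimX := dim_dirspace_le (support X).
rewrite -subSn// -[in RHS](subnK (leqW dimX)).
by rewrite exprD -mulrA -expr2 sqrr_sign mulr1.
Qed.

Lemma rank_sign_hat1 : rank_sign (hat1 A) = - (-1) ^+ n.+1.
Proof. by rewrite /rank_sign /= /int_rank eqxx exprS mulN1r. Qed.

Lemma fsval_face_hull F : fsval (face_hull F) = flat (zeros IT (signs F)).
Proof.
have FE : fsval F = cell (signs F).
  by apply/seteqP; split=> p; rewrite mem_face cellP.
rewrite /= FE affine_hull_cell; last by rewrite -FE; have [] := faceP F.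
by congr flat; apply/setP => i; rewrite !inE.
Qed.

Lemma face_sub_hull F p : fsval F p -> fsval (face_hull F) p.
Proof.
move=> /mem_face/ffunP Fp; rewrite fsval_face_hull => i.
rewrite /= inE => /andP[_ /eqP si]; apply/(@open_sideP _ _ _ i None).
by rewrite -si -Fp ffunE.
Qed.

Lemma face_hull_neq_empty F : face_hull F != empty.
Proof.
apply/eqP => hullF; have [_ [p /face_sub_hull]] := faceP F.
by rewrite hullF.
Qed.

Lemma support_face_hull F : support (face_hull F) = zeros IT (signs F).
Proof.
apply/setP => i; rewrite [RHS]inE finset.in_setT /=.
apply/mem_supportP/eqP => [Fi|si p].
  have [_ [p Fp]] := faceP F; have /ffunP/(_ i) := (mem_face F p).1 Fp.
  rewrite ffunE => <-; apply/open_sideP; exact/Fi/face_sub_hull.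
by rewrite fsval_face_hull; apply; rewrite /= !inE si.
Qed.

Lemma le_face_hull X F : X != empty ->
  (X <= face_hull F)%O = agree_on (support X) [ffun=> None] (signs F).
Proof.
move=> X0; rewrite le_support// support_face_hull.
apply/fintype.subsetP/agree_onP => XF i iX; have := XF i iX; rewrite ffunE.
  by rewrite !inE => /eqP.
by move=> si; rewrite !inE si.
Qed.

Lemma face_hull_anti F G : (F <= G)%O -> (face_hull G <= face_hull F)%O.
Proof.
rewrite face_leE le_support ?face_hull_neq_empty// !support_face_hull.
move=> /forallP FG; apply/fintype.subsetP => i; rewrite !inE => /eqP Gi.
by have := FG i; rewrite Gi; case: (signs F i).
Qed.

Lemma satisfiable_support X :
  X != empty -> satisfiable (support X) [ffun=> None].
Proof.
move=> X0; have [p] := flat_point X0; rewrite fsval_support// => Xp.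
apply/asboolP; exists p; apply/agree_onP => i iX; rewrite !ffunE.
by apply/open_sideP; exact: Xp.
Qed.

Lemma zeros_None D : zeros D [ffun=> None] = D.
Proof. by apply/setP => i; rewrite !inE ffunE eqxx andbT. Qed.

Definition face_sign F : int := rank_sign (BElt (face_hull F)).

Lemma face_signE F : face_sign F = (-1) ^+ n.+1 * euler_sign IT (signs F).
Proof.
by rewrite /face_sign rank_sign_flat ?face_hull_neq_empty// support_face_hull.
Qed.

Lemma sum_face_sign_agree D s : satisfiable D s ->
  \sum_(F | agree_on D s (signs F)) face_sign F =
  (-1) ^+ n.+1 * euler_sign D s.
Proof.
move=> sD; under eq_bigr do rewrite face_signE.
by rewrite -mulr_sumr sum_faces//; exact: euler_sign_additive.
Qed.

Lemma sum_face_sign_flat X : X != empty ->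
  \sum_(F | (X <= face_hull F)%O) face_sign F = rank_sign (BElt X).
Proof.
move=> X0; under eq_bigl do rewrite le_face_hull//.
rewrite sum_face_sign_agree ?satisfiable_support//.
by rewrite /euler_sign /cell_dim zeros_None rank_sign_flat.
Qed.

Lemma sum_face_sign_star X G : (X <= face_hull G)%O ->
  \sum_(F | (G <= F)%O && (X <= face_hull F)%O) face_sign F =
  rank_sign (BElt X).
Proof.
move=> XG; have X0 := flat_neq_le XG (face_hull_neq_empty G).
pose D := (support X :|: [set i | signs G i != None])%SET.
have GX i : i \in support X -> signs G i = None.
  by move: XG; rewrite le_face_hull// => /agree_onP GX /GX; rewrite ffunE.
have in_D i : (i \in D) = (i \in support X) || (signs G i != None).
  by rewrite finset.in_setU [in X in _ || X]inE.
have zeros_D : zeros D (signs G) = support X.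
  apply/setP => i; rewrite inE in_D.
  by have [/GX ->|_] := boolP (i \in support X); rewrite ?andNb.
have agree_D F :
    (G <= F)%O && (X <= face_hull F)%O = agree_on D (signs G) (signs F).
  rewrite le_face_hull// face_leE.
  apply/andP/agree_onP => [[/forallP GF /agree_onP FX] i|GF].
    rewrite in_D => /orP[iX|]; first by rewrite FX// ffunE GX.
    have := GF i; case: (signs G i) (signs F i) => [b|] [c|] //=.
    by move=> /eqP ->.
  split; last by apply/agree_onP => i iX; rewrite GF ?in_D ?iX// GX// ffunE.
  apply/forallP => i; case Gi : (signs G i) => [b|//].
  by rewrite GF ?Gi /= ?eqxx// in_D Gi orbT.
rewrite (eq_bigl _ _ agree_D) sum_face_sign_agree.
  by rewrite /euler_sign /cell_dim zeros_D rank_sign_flat.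
have [p Gp] := face_point G; apply: (@agree_on_satisfiable _ _ _ _ _ G).
by apply/agree_onP.
Qed.

Lemma essential_dirspace : essential A -> dirspace IT = 0%VS.
Proof.
move=> ess; apply/eqP; rewrite -subv0; apply/subvP => v /dirspaceP v_orth.
rewrite memv0; apply/eqP/dot_self_eq0.
have : v \in <<[seq normal i | i : I]>>%VS by rewrite ess memvf.
have /span_subvP span_ker : {subset [seq normal i | i : I] <=
    lker (linfun (dot v : 'rV[R]_n -> R^o))}.
  move=> _ /codomP[i ->]; rewrite memv_ker lfunE /= dotC; apply/eqP/v_orth.
  by rewrite inE.
by move=> /(subvP span_ker); rewrite memv_ker lfunE => /eqP.
Qed.

Lemma bounded_sign_face F : essential A ->
  bounded_sign IT (signs F) =
  if face_bounded F then euler_sign IT (signs F) else 0.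
Proof.
move=> ess; rewrite /bounded_sign /cone_sign essential_dirspace// dimv0.
have -> : lineal (recession IT (signs F)) = face_bounded F.
  apply/asboolP/face_boundedP => [lin v rv|rec0 v rv]; last first.
    by rewrite (rec0 v rv) oppr0 -(rec0 v rv).
  apply/eqP; rewrite -memv0 -(essential_dirspace ess).
  by rewrite (mem_dirspace _ (signs F)) rv lin.
by case: ifP; rewrite ?mulr1 ?mulr0.
Qed.

Lemma bounded_sign_None D : bounded_sign D [ffun=> None] = 1.
Proof.
rewrite /bounded_sign /cone_sign /lineal asboolT => [|v /forall_inP rv].
  by rewrite /euler_sign /cell_dim zeros_None -expr2 sqrr_sign.
apply/forall_inP => i iD; have := rv i iD.
by rewrite ffunE !sign_le0 dotN oppr_eq0.
Qed.

Lemma sum_face_sign_bounded X : essential A -> X != empty ->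
  \sum_(F | face_bounded F && (X <= face_hull F)%O) face_sign F =
  - rank_sign (hat1 A).
Proof.
move=> ess X0; rewrite rank_sign_hat1 opprK.
transitivity ((-1) ^+ n.+1 * bounded_sign (support X) [ffun=> None]);
  last by rewrite bounded_sign_None mulr1.
rewrite -(sum_faces (@bounded_sign_additive R n A)) ?satisfiable_support//.
rewrite mulr_sumr big_mkcondl /=.
apply: eq_big => [F|F _]; first by rewrite le_face_hull.
rewrite bounded_sign_face// face_signE.
by case: (face_bounded F); rewrite ?mulr0.
Qed.

End Flats.

(** * Zaslavsky's counts *)

Section FaceCounts.
Variables (R : realType) (n : nat) (A : arrangement R n).
Local Notation rank := (@int_rank0 R n A).
Local Notation empty := (empty_flat A).
Implicit Types (F G : face A) (X Z : int_lattice A) (y z : int_lattice0 A).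

Lemma card_faces_mobius (q : pred (face A)) (f : int_lattice0 A -> int) X y :
  (forall F, q F -> (BElt (face_hull F) <= y)%O) ->
  (forall Z, (X <= Z)%O -> (BElt Z <= y)%O ->
     \sum_(F | q F && (Z <= face_hull F)%O) face_sign F = f (BElt Z)) ->
  #|[pred F | q F && (face_hull F == X)]|%:Z =
  \sum_(z | (BElt X <= z <= y)%O) rank_sign (BElt X) * f z * mobius (BElt X) z.
Proof.
move=> qy fE; under eq_bigr do rewrite -mulrA.
rewrite -mulr_sumr; under eq_bigr do rewrite -mulrzz.
rewrite -(mobius_inversion_fibers (h := fun F => BElt (face_hull F))
  (w := @face_sign R n A) qy) => [|[|Z] // /andP[XZ Zy]].
  rewrite (eq_bigl [pred F | q F && (face_hull F == X)]) => [|F]; last first.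
    by rewrite inE; congr (_ && _); apply/eqP/eqP => [[]|->].
  rewrite (eq_bigr (fun=> rank_sign (BElt X))) => [|F /andP[_ /eqP <-]//].
  by rewrite sumr_const -mulr_natr mulrA rank_sign_sqr mul1r natz.
exact: fE.
Qed.

Lemma card_star_faces X G : (X <= face_hull G)%O ->
  #|[pred F | (G <= F)%O && (face_hull F == X)]|%:Z =
  Zint rank (BElt X) (BElt (face_hull G)).
Proof.
move=> XG; rewrite (@card_faces_mobius _ (@rank_sign R n A) _
  (BElt (face_hull G))) => [|F /face_hull_anti //|Z _ ZG]; last first.
  exact: sum_face_sign_star.
by apply: eq_bigr => z /andP[Xz _]; rewrite rank_signB.
Qed.

Lemma sum_face_hull_empty (q : pred (face A)) :
  \sum_(F | q F && (empty <= face_hull F)%O) face_sign F = 0.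
Proof.
rewrite big_pred0// => F; apply/negbTE; rewrite negb_and; apply/orP; right.
by apply: contra (face_hull_neq_empty F) => le; rewrite eq_le le le_empty_flat.
Qed.

Lemma card_faces X : X != empty ->
  #|[pred F | face_hull F == X]|%:Z =
  Zint rank (BElt X) (hat1 A) - Zint_b rank (BElt X) (hat1 A).
Proof.
move=> X0; have X1 : (BElt X <= hat1 A)%O by exact: le_empty_flat.
transitivity #|[pred F | xpredT F && (face_hull F == X)]|%:Z; first by [].
rewrite (@card_faces_mobius _ (fun z => if z == hat1 A then 0 else rank_sign z)
  X (hat1 A)) => [|F _|Z _ _]; last 2 first.
- exact: le_empty_flat.
- case: eqP => [[->]|Z1]; first exact: sum_face_hull_empty.
  by rewrite sum_face_sign_flat//; apply: contra_notN Z1 => /eqP ->.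
rewrite (bigD1 (hat1 A)) ?X1 ?lexx//= eqxx mulr0 mul0r add0r.
rewrite [Zint _ _ _](bigD1 (hat1 A)) ?X1 ?lexx//= addrAC subrr add0r.
apply: eq_bigr => z /andP[/andP[Xz _] /negbTE ->].
by rewrite -rank_signB.
Qed.

Lemma card_bounded_faces X : essential A -> X != empty ->
  #|[pred F | face_bounded F && (face_hull F == X)]|%:Z =
  Zint_b rank (BElt X) (hat1 A).
Proof.
move=> ess X0; pose x : int_lattice0 A := BElt X.
have x1 : (x <= hat1 A)%O by exact: le_empty_flat.
rewrite (@card_faces_mobius _
  (fun z => if z == hat1 A then 0 else - rank_sign (hat1 A))
  X (hat1 A)) => [|F _|Z _ _]; last 2 first.
- exact: le_empty_flat.
- case: eqP => [[->]|Z1]; first exact: sum_face_hull_empty.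
  by rewrite sum_face_sign_bounded//; apply: contra_notN Z1 => /eqP ->.
rewrite -/x (bigD1 (hat1 A)) ?x1 ?lexx//= eqxx mulr0 mul0r add0r.
transitivity (\sum_(z | (x <= z <= hat1 A)%O && (z != hat1 A))
    - (rank_sign x * rank_sign (hat1 A)) * mobius x z).
  by apply: eq_bigr => z /andP[_ /negbTE ->]; rewrite mulrN.
rewrite -mulr_sumr /Zint_b rank_signB// mulNr -mulrN; congr (_ * _).
have : (x < hat1 A)%O.
  by rewrite lt_neqAle x1 andbT; apply: contraNneq X0 => -[->].
move/mobius_sum; rewrite (bigD1 (hat1 A)) ?x1 ?lexx//= => /eqP.
by rewrite addr_eq0 => /eqP ->.
Qed.

Lemma card_unbounded_faces X : essential A -> X != empty ->
  #|[pred F | ~~ face_bounded F && (face_hull F == X)]|%:Z =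
  Zint_ub rank (BElt X) (hat1 A).
Proof.
move=> ess X0; apply: (@addrI _ (Zint_b rank (BElt X) (hat1 A))).
transitivity #|[pred F | face_hull F == X]|%:Z; last first.
  by rewrite card_faces// /Zint_ub mulrDl mul1r opprD addrCA addNKr addrC.
rewrite -card_bounded_faces// -PoszD -[in RHS](cardID (@face_bounded R n A)).
by congr (Posz (_ + _)); apply: eq_card => F; rewrite !inE andbC.
Qed.

End FaceCounts.

(** * The poset of unbounded faces *)

Section UnboundedPoset.
Variables (R : realType) (n : nat) (A : arrangement R n).
Local Notation rank := (@int_rank0 R n A).
Local Notation empty := (empty_flat A).
Local Notation dual_face F := (BElt (TElt F) : (face_lattice A)^d).
Implicit Types (F G : face A) (X Y : int_lattice A) (y : Qposet A)
  (a b : int_lattice0 A).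

Lemma BElt_inj (P : Type) : injective (@BElt P).
Proof. by move=> p q []. Qed.

Definition ub_min : unbounded_part A :=
  @UnboundedPart R n A (BElt Top : face_lattice A) isT.

Definition Qmin : Qposet A := TElt ub_min.

(* Sends bounded faces to the junk value [Qmin]. *)
Definition Qface F : Qposet A := TElt (insubd ub_min (dual_face F)).

Lemma ub_val_Qface F : ~~ face_bounded F ->
  ub_val (insubd ub_min (dual_face F)) = dual_face F.
Proof.
move=> Fu; apply: (@insubdK _ _ (unbounded_part A)).
by rewrite unfold_in /= asbool_neg.
Qed.

Lemma z_ub_Qface F : ~~ face_bounded F -> z_ub (Qface F) = BElt (face_hull F).
Proof. by move=> Fu; rewrite /z_ub /Qface ub_val_Qface. Qed.

Lemma Qface_inj : {in [pred F | ~~ face_bounded F] &, injective Qface}.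
Proof.
move=> F G Fu Gu [] /(congr1 (@ub_val R n A)).
by rewrite !ub_val_Qface// => -[].
Qed.

Lemma le_TElt (t u : unbounded_part A) :
  ((TElt t : Qposet A) <= TElt u)%O = (ub_val t <= ub_val u)%O.
Proof. by []. Qed.

Lemma le_Qface F G : ~~ face_bounded F -> ~~ face_bounded G ->
  (Qface F <= Qface G)%O = (G <= F)%O.
Proof. by move=> Fu Gu; rewrite le_TElt !ub_val_Qface. Qed.

Lemma QposetP y :
  [\/ y = Top, y = Qmin | exists2 F, ~~ face_bounded F & y = Qface F].
Proof.
case: y => [|[[|[|F]] // yP]]; [by constructor 1| |].
  by constructor 2; congr TElt; apply: val_inj.
have Fu : ~~ face_bounded F by rewrite /face_bounded -asbool_neg.
constructor 3; exists F => //; congr TElt; apply: val_inj.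
by rewrite /= ub_val_Qface.
Qed.

Lemma z_ub_hat1 y : (z_ub y == hat1 A) = (y == Top).
Proof.
apply/eqP/eqP => [|-> //]; have [->//|->//|[F Fu ->]] := QposetP y.
rewrite z_ub_Qface// => hull_empty; case/eqP: (face_hull_neq_empty F).
exact: BElt_inj hull_empty.
Qed.

Lemma z_ub_hat0 y : (z_ub y == hat0 A) = (y == Qmin).
Proof.
apply/eqP/eqP => [|-> //]; have [->//|->//|[F Fu ->]] := QposetP y.
by rewrite z_ub_Qface.
Qed.

Lemma z_ub_flat y X : X != empty -> z_ub y = BElt X ->
  exists F, [/\ ~~ face_bounded F, y = Qface F & face_hull F = X].
Proof.
move=> X0; have [->|->//|[F Fu ->]] := QposetP y.
  by move=> XE; rewrite -(BElt_inj XE) eqxx in X0.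
by rewrite z_ub_Qface// => XE; exists F; split=> //; exact: BElt_inj XE.
Qed.

Lemma le_Qmin y : (Qmin <= y)%O.
Proof.
have [->//|->//|[F Fu ->]] := QposetP y.
by rewrite le_TElt ub_val_Qface.
Qed.

Lemma le_Qtop y : (y <= (Top : Qposet A))%O.
Proof. by case: y. Qed.

Lemma card_z_ub_fiber (q : pred (Qposet A)) (r : pred (face A)) X :
  X != empty ->
  (forall F, face_hull F = X -> ~~ face_bounded F && q (Qface F) = r F) ->
  #|[pred y | (z_ub y == BElt X) && q y]| =
  #|[pred F | r F && (face_hull F == X)]|.
Proof.
move=> X0 qr.
have inj : {in [pred F | r F && (face_hull F == X)] &, injective Qface}.
  move=> F G; rewrite !inE => /andP[+ /eqP FX] /andP[+ /eqP GX].
  by rewrite -!qr// => /andP[Fu _] /andP[Gu _]; exact: Qface_inj.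
rewrite -(card_in_imset inj); apply: eq_card => y.
rewrite inE; apply/andP/imsetP => [[/eqP/(z_ub_flat X0)[F [Fu -> FX]] qy]|[F]].
  by exists F; rewrite // inE FX eqxx andbT -qr// Fu.
rewrite inE => /andP[rF /eqP FX] ->; move: rF; rewrite -qr// => /andP[Fu qF].
by rewrite z_ub_Qface// FX.
Qed.

Lemma card_below_hat0 y : z_ub y != hat0 A ->
  #|[pred y' | (z_ub y' == hat0 A) && (y' < y)%O]| = 1%N.
Proof.
move=> y0; rewrite -(card1 Qmin); apply: eq_card => y'.
rewrite !inE z_ub_hat0; case: eqP => //= ->.
by rewrite lt_neqAle le_Qmin andbT eq_sym -z_ub_hat0.
Qed.

Lemma card_below_top X : essential A -> X != empty ->
  #|[pred y' | (z_ub y' == BElt X) && (y' < (Top : Qposet A))%O]|%:Z =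
  Zint_ub rank (BElt X) (hat1 A).
Proof.
move=> ess X0; rewrite -card_unbounded_faces//; congr Posz.
by apply: card_z_ub_fiber => // F _; rewrite lt_neqAle le_Qtop !andbT.
Qed.

(* A face whose closure contains an unbounded face is unbounded, so all the
   faces counted by [card_star_faces] belong to [Qposet A]. *)
Lemma card_below_face y X Y : (X < Y)%O -> Y != empty -> z_ub y = BElt Y ->
  #|[pred y' | (z_ub y' == BElt X) && (y' < y)%O]|%:Z =
  Zint rank (BElt X) (BElt Y).
Proof.
move=> XY Y0 /(z_ub_flat Y0)[G [Gu -> GY]].
have X0 := flat_neq_le (ltW XY) Y0.
rewrite -GY -card_star_faces ?GY ?ltW//; congr Posz.
apply: (card_z_ub_fiber X0) => F FX.
apply/andP/idP => [[Fu /ltW]|GF]; first by rewrite le_Qface.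
have Fu : ~~ face_bounded F by apply: contra Gu; exact: face_bounded_le.
split=> //; rewrite lt_neqAle le_Qface// GF andbT.
apply: contraTneq XY => /Qface_inj; rewrite !inE => /(_ Fu Gu) FG.
by rewrite -FX -GY FG ltxx.
Qed.

Definition lift_count a b : int :=
  if a == hat0 A then 1
  else if b == hat1 A then Zint_ub rank a b else Zint rank a b.

Lemma card_below y a b : essential A -> (a < b)%O -> z_ub y = b ->
  #|[pred y' | (z_ub y' == a) && (y' < y)%O]|%:R = lift_count a b.
Proof.
move=> ess ab yb; rewrite natz /lift_count; case: eqVneq => [a0|a0].
  by rewrite a0 card_below_hat0// yb gt_eqF// -a0.
case: a ab a0 => [|X] // ab _.
case: b yb ab => [|Y] // yb ab.
case: eqVneq => [b1|Y1]; last first.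
  by apply: card_below_face yb; rewrite //; apply: contraNneq Y1 => ->.
have -> : y = Top by apply/eqP; rewrite -z_ub_hat1 yb b1.
rewrite b1 card_below_top//; apply: contraTneq ab => ->.
by rewrite b1 ltxx.
Qed.

Lemma prod_lift_count k (x : k.+1.-tuple (int_lattice0 A)) :
  (2 <= k)%N -> sorted <%O x ->
  nth (hat0 A) x 0 = hat0 A -> nth (hat0 A) x k = hat1 A ->
  \prod_(0 <= i < k) lift_count (nth (hat0 A) x i) (nth (hat0 A) x i.+1) =
  (\prod_(2 <= i < k) Zint rank (nth (hat0 A) x i.-1) (nth (hat0 A) x i)) *
  Zint_ub rank (nth (hat0 A) x k.-1) (nth (hat0 A) x k).
Proof.
case: k x => [|[|k]] // x _ x_sorted x0 xk.
have x_uniq i j (ik : (i <= k.+2)%N) (jk : (j <= k.+2)%N) :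
    (nth (hat0 A) x i == nth (hat0 A) x j) = (i == j).
  by rewrite nth_uniq ?size_tuple// (lt_sorted_uniq x_sorted).
have x_hat0 i (ik : (i <= k.+2)%N) : (nth (hat0 A) x i == hat0 A) = (i == 0%N).
  by rewrite -(x_uniq i 0%N)// x0.
have x_hat1 i (ik : (i <= k.+2)%N) : (nth (hat0 A) x i == hat1 A) = (i == k.+2).
  by rewrite -(x_uniq i k.+2)// xk.
rewrite big_nat_recl// big_nat_recr//= {1}/lift_count x0 eqxx mul1r.
congr (_ * _); last by rewrite /lift_count x_hat0// x_hat1 ?eqxx.
rewrite [RHS](big_addn 0 _ 2) subn2; apply: eq_big_nat => i ik.
rewrite addn2 /lift_count x_hat0 ?x_hat1; [|lia..].
by rewrite (ltn_eqF (ik : i.+2 < k.+2)%N).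
Qed.

End UnboundedPoset.

Theorem theorem4p2 (R : realType) (n : nat) (A : arrangement R n)
    (k : nat) (x : k.+1.-tuple (int_lattice0 A)) :
  essential A -> noncentral A -> (2 <= k)%N ->
  sorted <%O x -> nth (hat0 A) x 0 = hat0 A -> nth (hat0 A) x k = hat1 A ->
  #|[pred y : k.+1.-tuple (Qposet A) |
      sorted <%O y && [forall i, z_ub (tnth y i) == tnth x i]]|%:Z =
  (\prod_(2 <= i < k)
      Zint (@int_rank0 R n A) (nth (hat0 A) x i.-1) (nth (hat0 A) x i)) *
  Zint_ub (@int_rank0 R n A) (nth (hat0 A) x k.-1) (nth (hat0 A) x k).
Proof.
move=> ess _ k2 x_sorted x0 xk.
transitivity (#|chain_lifts <%O (@z_ub R n A) x|%:R : int).
  by rewrite natz; congr Posz; apply: eq_card => y; rewrite !inE eq_map_tnth.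
have below a b y := @card_below R n A y a b ess.
rewrite (card_chain_lifts below (hat0 A))// prod_lift_count// xk.
rewrite (eq_card (B := pred1 (Top : Qposet A))) ?card1 ?mulr1// => y.
by rewrite !inE z_ub_hat1.
Qed.
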